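(* There exists a constant $c>0$ such that for all positive integers $k_1<k_2<k_3$ with $k_3\neq k_1+k_2$, all $0<\alpha<1/2$, and all sufficiently large primes $N>N_0(\alpha,k_1,k_2,k_3)$, there exists $f:\mathbb{Z}/N\mathbb{Z}\to[0,1]$ with $\mathbb{E}f\ge\alpha$ such that for every nonzero $d\in\mathbb{Z}/N\mathbb{Z}$, \[\mathbb{E}_tf(t)f(t+k_1d)f(t+k_2d)f(t+k_3d)<(1-c)\alpha^4.\]
   Context: Expectations are over the uniform distribution on $\mathbb{Z}/N\mathbb{Z}$. *)

(* Defs.v *)
From mathcomp Require Import all_boot all_order all_algebra.
From mathcomp Require Import reals.

Set Implicit Arguments.
Unset Strict Implicit.
Unset Printing Implicit Defensive.

Import GRing.Theory.
Local Open Scope ring_scope.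

Definition expectation (R : realType) (T : finType) (F : T -> R) : R :=
  (\sum_(t : T) F t) / #|T|%:R.

(* Main.v *)
Require Import Defs.
From mathcomp Require Import all_boot all_order all_algebra.
From mathcomp Require Import reals.
From mathcomp Require Import complex.
From mathcomp Require Import zify ring lra.

Set Implicit Arguments.
Unset Strict Implicit.
Unset Printing Implicit Defensive.

Import Order.TTheory GRing.Theory Num.Theory.
Local Open Scope ring_scope.

(* With [k] the positions of the four points, pick integers [c_s] annihilating
   [1], [k] and [k^2], so that [sum_s c_s (t + k_s d)^2] vanishes identically.
   Perturbing the constant [alpha] by the quadratic characters of frequencies
   [c_s t^2 + lambda_s t], with one negative coefficient, makes the 4-fold
   correlation gain a fixed negative fourth-order term for every [d]; the linear
   twists [lambda_s] and the sizes [eps ^+ wt s] dispose of the other relations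
   among the frequencies.  Relations obtained by permuting the [c_s] can occur
   for special [k]: replacing each character by its multiples by
   [u(v) = sum_r D^r v_r], [v] a sign vector of length [m], turns the
   contribution of such a permutation into a Riesz product
   [1 - prod_r (1 + cos)] of bounded positive part, whereas the identity contributes
   [1 - 2^m].  Finally [G] copies at well separated scales are superposed with
   amplitude [mu ~ 1 / G].  A relation depending on [d] singles out one scale
   and costs [O(mu^3)], the gain is [K mu^3] with [K] large, and truncating the
   perturbation to [[-1/2, 1/2]] costs [O(G^4 mu^8)] through the eighth moment. *)

(** The hypothesis [k3 <> k1 + k2] says that the outer gaps [a = k1] and [c = k3 - k2] differ. If
    they agreed, the annihilating coefficients would have the form [-p, q, -q, p]: the untwisted
    characters would pair off into conjugates and the main product could not be made negative. A
    reflection of the configuration then allows [a < c].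

    One scale is not enough: for special [d] the congruence [2 d P + L = 0] modulo [N], with [P] and
    [L] the first moment of the quadratic frequencies and the sum of the linear ones, can hold for
    patterns of three atoms, of size [mu^3] against a gain of order [mu^4]. Quadratic frequencies at
    scale [g] are multiplied by [B^g] and linear ones by [B^(2 g)], so the ratio [L / P] reveals
    [g]. The patterns inside one scale are counted in terms of [m] alone; hence [K], [G] and the
    final constant do not depend on the positions.

    The order eight of the moment is forced: with [mu = K / G], a moment of order [2 j] costs about
    [G^j mu^(2 j)], of order [G^(-j)], and [j = 4] is the first value for which this is negligible
    against [mu^3]. *)

Lemma primitive_root_exists (C : numClosedFieldType) (N : nat) :
  prime N -> exists w : C, N.-primitive_root w.
Proof.
move=> N_prime; have N_gt1 := prime_gt1 N_prime; have N_gt0 := prime_gt0 N_prime.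
(* A root of [1 + X + ... + X^(N-1)] is taken. Its [N]-th power is [1], and it is not [1], where the
   value is [N]; primality excludes every order other than [N]. *)
have sz : size (\poly_(i < N) (1 : C)) = N.
  by rewrite size_poly_eq // oner_neq0.
have : exists x, root (\poly_(i < N) (1 : C)) x.
  by apply/closed_rootP; rewrite sz; case: (N) N_gt1 => [|[]].
case=> w; rewrite /root horner_poly => /eqP sw.
have sw0 : \sum_(i < N) w ^+ i = 0.
  by rewrite -[RHS]sw; apply: eq_bigr => i _; rewrite mul1r.
have wN : w ^+ N = 1 by apply/eqP; rewrite -subr_eq0 subrX1 sw0 mulr0.
have [m mw mN] := prim_order_exists N_gt0 wN.
case/primeP: N_prime => _ /(_ _ mN) /orP [] /eqP Em; last first.
  by exists w; rewrite -Em.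
have w1 : w = 1 by move: mw; rewrite Em => /prim_expr_order; rewrite expr1.
move/eqP: sw0; rewrite w1 (eq_bigr (fun=> 1)); last by move=> i _; rewrite expr1n.
by rewrite sumr_const card_ord pnatr_eq0; case: (N) N_gt0.
Qed.

Lemma ltn_Zp (N : nat) (x : 'Z_N) : prime N -> (x < N)%N.
Proof. by move=> /prime_gt1 N_gt1; apply: leq_trans (ltn_ord x) _; rewrite Zp_cast. Qed.

Lemma Zp_mulf_eq0 (N : nat) (x y : 'Z_N) : prime N -> x * y = 0 -> x = 0 \/ y = 0.
Proof.
move=> N_prime /(congr1 val) /=; have N_gt1 := prime_gt1 N_prime.
have -> : ((x * y) %% (Zp_trunc N).+2)%N = ((x * y) %% N)%N.
  by congr modn; exact: Zp_cast.
have xN := ltn_Zp x N_prime.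
have yN := ltn_Zp y N_prime.
move/eqP; rewrite -/(dvdn _ _) Euclid_dvdM // => /orP [] dv; [left|right]; apply: val_inj => /=.
  by move: dv xN; case: (nat_of_ord x) => // n /dvdn_leq -/(_ isT); lia.
by move: dv yN; case: (nat_of_ord y) => // n /dvdn_leq -/(_ isT); lia.
Qed.

(** * Additive characters modulo [N] and quadratic exponential sums *)

Section AdditiveCharacter.
Variables (R : realType) (N : nat).
Hypothesis N_prime : prime N.
Local Notation C := (complex R).
Local Notation Re := complex.Re.

Let N_gt1 : (1 < N)%N := prime_gt1 N_prime.
Let N_gt0 : (0 < N)%N := prime_gt0 N_prime.

Variable w : C.
Hypothesis w_prim : N.-primitive_root w.

Definition chi (x : 'Z_N) : C := w ^+ x.

Lemma chi0 : chi 0 = 1. Proof. by rewrite /chi expr0. Qed.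

Lemma chiD x y : chi (x + y) = chi x * chi y.
Proof.
rewrite /chi -exprD /=.
have -> : ((x + y) %% (Zp_trunc N).+2)%N = ((x + y) %% N)%N.
  by congr modn; exact: Zp_cast.
by rewrite expr_mod ?(prim_expr_order w_prim).
Qed.

Lemma chi_sum (I : Type) (r : seq I) (P : pred I) (F : I -> 'Z_N) :
  chi (\sum_(i <- r | P i) F i) = \prod_(i <- r | P i) chi (F i).
Proof. exact: (big_morph chi chiD chi0). Qed.

Lemma norm_chi x : `|chi x| = 1.
Proof.
rewrite /chi normrX; suff -> : `|w| = 1 by rewrite expr1n.
apply/eqP; rewrite -(@pexpr_eq1 _ _ N) ?normr_ge0 //.
by rewrite -normrX (prim_expr_order w_prim) normr1.
Qed.

Lemma conj_chi x : conjc (chi x) = chi (- x).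
Proof.
have E : chi x * conjc (chi x) = 1.
  by have := normCK (chi x); rewrite norm_chi expr1n => ->.
have nz : chi x != 0 by rewrite -normr_gt0 norm_chi ltr01.
apply: (mulfI nz); rewrite E -chiD subrr.
by rewrite chi0.
Qed.

Lemma ReD (x y : C) : Re (x + y) = Re x + Re y.
Proof. by case: x y => [a b] [c d]. Qed.

Lemma Re_sum (I : Type) (r : seq I) (P : pred I) (F : I -> C) :
  Re (\sum_(i <- r | P i) F i) = \sum_(i <- r | P i) Re (F i).
Proof. exact: (big_morph _ ReD erefl). Qed.

Lemma Re_realM (a : R) (z : C) : Re ((real_complex R a) * z) = a * Re z.
Proof. by case: z => x y /=; rewrite mul0r subr0. Qed.

Lemma Re_chi_bound x : -1 <= Re (chi x) <= 1.
Proof.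
have := norm_chi x; rewrite normc_def => -[] /= /eqP.
rewrite -(@eqrXn2 _ 2%N) ?sqrtr_ge0 // sqr_sqrtr ?addr_ge0 ?sqr_ge0 //.
rewrite expr1n => /eqP E.
have := sqr_ge0 (complex.Im (chi x)); move: E; rewrite !expr2 => E h.
by apply/andP; split; nra.
Qed.

Lemma chi_neq1 x : x != 0 -> chi x != 1.
Proof.
move=> x0; rewrite /chi -(prim_order_dvd w_prim).
have xN := ltn_Zp x N_prime.
apply: contra x0 => dv; apply/eqP/val_inj => /=.
by move: dv xN; case: (nat_of_ord x) => // n /dvdn_leq -/(_ isT); lia.
Qed.

Lemma sum_chi v : v != 0 -> \sum_(t : 'Z_N) chi (v * t) = 0.
Proof.
move=> v0; set S := \sum_t _.
have E : S = chi v * S.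
  rewrite {1}/S (reindex_inj (addIr (1 : 'Z_N))) /= mulr_sumr.
  by apply: eq_bigr => t _; rewrite mulrDr mulr1 addrC chiD.
apply/eqP; have /eqP : (1 - chi v) * S = 0 by rewrite mulrBl mul1r -E subrr.
by rewrite mulf_eq0 subr_eq0 eq_sym (negbTE (chi_neq1 v0)).
Qed.

Definition gauss (u v z : 'Z_N) : R :=
  expectation (fun t : 'Z_N => Re (chi (u * t ^+ 2 + v * t + z))).

Lemma card_Zp_prime : #|'Z_N| = N.
Proof. by rewrite card_ord Zp_cast. Qed.

Lemma gauss_const z : gauss 0 0 z = Re (chi z).
Proof.
rewrite /gauss /expectation (eq_bigr (fun=> Re (chi z))); last first.
  by move=> t _; rewrite !mul0r !add0r.
rewrite sumr_const; transitivity (Re (chi z) * #|'Z_N|%:R / #|'Z_N|%:R).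
  by rewrite mulr_natr.
rewrite mulfK // card_Zp_prime pnatr_eq0.
by rewrite -lt0n.
Qed.

Lemma gauss_linear v z : v != 0 -> gauss 0 v z = 0.
Proof.
move=> v0; rewrite /gauss /expectation -Re_sum.
rewrite (eq_bigr (fun t => chi z * chi (v * t))); last first.
  by move=> t _; rewrite mul0r add0r addrC chiD.
by rewrite -mulr_sumr sum_chi // mulr0 /= mul0r.
Qed.

(** In [S * conjc S] the substitution [i = s + t] makes the phase linear in [t] with slope [2 u s],
    so only [s = 0] survives and [|S|^2 = N]. Any [e] with [e^2 >= 1 / N] is allowed, which avoids
    square roots. *)
Lemma gauss_quadratic (e : R) u v z : 0 <= e -> (N%:R)^-1 <= e ^+ 2 ->
  (2 : 'Z_N) != 0 -> u != 0 -> `|gauss u v z| <= e.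
Proof.
move=> e0 eN n2 u0.
set S := \sum_(t : 'Z_N) chi (u * t ^+ 2 + v * t + z).
have SS : S * conjc S = N%:R.
  rewrite /S (big_morph _ (rmorphD (@conjc R)) (rmorph0 (@conjc R))) mulr_sumr.
  under eq_bigr => t _ do rewrite mulr_suml.
  have step t : \sum_(i : 'Z_N) chi (u * i ^+ 2 + v * i + z) *
       conjc (chi (u * t ^+ 2 + v * t + z)) =
     \sum_(s : 'Z_N) chi (u * s ^+ 2 + v * s) * chi (2 * u * s * t).
    rewrite (reindex_inj (addIr (t : 'Z_N))) /=; apply: eq_bigr => s _.
    rewrite conj_chi -!chiD; congr chi; ring.
  under eq_bigr => t _ do rewrite step.
  rewrite exchange_big /= (bigD1 (0 : 'Z_N)) //= [X in _ + X]big1 ?addr0.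
    rewrite (eq_bigr (fun=> 1)); last first.
      by move=> t _; rewrite expr0n /= !mulr0 mul0r addr0 chi0 mul1r.
    by rewrite sumr_const card_Zp_prime.
  move=> s s0; rewrite -mulr_sumr sum_chi ?mulr0 //.
  apply/eqP => /(Zp_mulf_eq0 N_prime) [/(Zp_mulf_eq0 N_prime) []|] H; first by rewrite H eqxx in n2.
    by rewrite H eqxx in u0.
  by rewrite H eqxx in s0.
have ReS : (Re S) ^+ 2 <= N%:R.
  have : Re (S * conjc S) = N%:R.
    by rewrite SS -(rmorph_nat (real_complex R)).
  case: (S) => a b /= <-; rewrite mulrN opprK -!expr2.
  by rewrite lerDl sqr_ge0.
rewrite /gauss /expectation -Re_sum -/S card_Zp_prime.
rewrite -(@ler_pXn2r _ 2%N) ?nnegrE // real_normK ?num_real //.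
apply: le_trans eN; rewrite expr_div_n ler_pdivrMr ?exprn_gt0 ?ltr0n //.
by rewrite expr2 mulKf ?pnatr_eq0 -?lt0n //; exact: ReS.
Qed.

Lemma gauss_le1 u v z : `|gauss u v z| <= 1.
Proof.
rewrite /gauss /expectation normrM [X in _ * X]ger0_norm ?invr_ge0 ?ler0n //.
rewrite ler_pdivrMr ?ltr0n card_Zp_prime // mul1r.
apply: le_trans (ler_norm_sum _ _ _) _.
have -> : N%:R = \sum_(t : 'Z_N) (1 : R).
  by rewrite sumr_const; congr (_ *+ _); exact/esym/card_Zp_prime.
apply: ler_sum => t _.
by rewrite ler_norml Re_chi_bound.
Qed.

End AdditiveCharacter.

(** * Trigonometric polynomials with quadratic phases *)

Section Expansion.
Variables (R : realType) (N : nat).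
Hypothesis N_prime : prime N.
Variable w : complex R.
Hypothesis w_prim : N.-primitive_root w.
Variables (T : finType) (kappa : T -> R) (A L : T -> int) (neg : T -> T).
Hypothesis negK : involutive neg.
Hypothesis kappa_neg : forall x, kappa (neg x) = kappa x.
Hypothesis A_neg : forall x, A (neg x) = - A x.
Hypothesis L_neg : forall x, L (neg x) = - L x.

Local Notation Re := complex.Re.
Local Notation rc := (real_complex R).
Local Notation phase x t := (chi w ((A x)%:~R * t ^+ 2 + (L x)%:~R * t)).

Definition trig_poly (t : 'Z_N) : R := \sum_x kappa x * Re (phase x t).

(** The involution [neg] pairs each phase with its conjugate under the same coefficient, so the
    complex sum is real. Without the real parts, products expand multiplicatively in characters. *)
Lemma trig_poly_complex t : rc (trig_poly t) = \sum_x rc (kappa x) * phase x t.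
Proof.
set S := \sum_x _.
have ReS : Re S = trig_poly t.
  by rewrite /S Re_sum; apply: eq_bigr => x _; rewrite Re_realM.
have cS : conjc S = S.
  rewrite {1}/S (big_morph _ (rmorphD (@conjc R)) (rmorph0 (@conjc R))).
  rewrite [RHS](reindex_inj (inv_inj negK)) /=; apply: eq_bigr => x _.
  have cr : conjc (rc (kappa x)) = rc (kappa x) by congr (Complex _ _); rewrite oppr0.
  have conjM (y z : complex R) : conjc (y * z) = conjc y * conjc z.
    exact: (rmorphM (@conjc R)).
  rewrite conjM cr conj_chi // kappa_neg A_neg L_neg.
  congr (_ * chi w _); by rewrite !rmorphN /= !mulNr opprD.
rewrite -ReS; case: (S) cS => a b [] /= Eb; congr (Complex _ _).
by lra.
Qed.

(** The coefficient of [t^2] does not involve [d]. The coefficient of [t] couples the first moment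
    of [A] with [L] through [d]: this is the source of relations that hold only for special
    differences. *)
Lemma correlation_expansion n (k : 'I_n -> int) (d : 'Z_N) :
  expectation (fun t : 'Z_N => \prod_(i < n) trig_poly (t + (k i)%:~R * d)) =
  \sum_(X : {ffun 'I_n -> T}) (\prod_(i < n) kappa (X i)) *
    gauss w (\sum_(i < n) A (X i))%:~R
      (2 * d * (\sum_(i < n) A (X i) * k i)%:~R + (\sum_(i < n) L (X i))%:~R)
      (d ^+ 2 * (\sum_(i < n) A (X i) * k i ^+ 2)%:~R
       + d * (\sum_(i < n) L (X i) * k i)%:~R).
Proof.
have E (t : 'Z_N) : \prod_(i < n) trig_poly (t + (k i)%:~R * d) =
  \sum_(X : {ffun 'I_n -> T}) (\prod_(i < n) kappa (X i)) *
   Re (chi w ((\sum_(i < n) A (X i))%:~R * t ^+ 2 +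
      (2 * d * (\sum_(i < n) A (X i) * k i)%:~R + (\sum_(i < n) L (X i))%:~R) * t
      + (d ^+ 2 * (\sum_(i < n) A (X i) * k i ^+ 2)%:~R
       + d * (\sum_(i < n) L (X i) * k i)%:~R))).
  have -> : \prod_(i < n) trig_poly (t + (k i)%:~R * d) =
      Re (\prod_(i < n) rc (trig_poly (t + (k i)%:~R * d))).
    by rewrite -rmorph_prod.
  under eq_bigr => i _ do rewrite trig_poly_complex.
  rewrite bigA_distr_bigA /= Re_sum; apply: eq_bigr => X _.
  rewrite big_split /= -rmorph_prod -chi_sum // -Re_realM; congr (Re (_ * chi w _)).
  rewrite !rmorph_sum /= !(mulr_suml, mulr_sumr) -!big_split /= mulr_suml -!big_split /=.
  apply: eq_bigr => i _; rewrite !rmorphM /=. ring.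
rewrite /expectation (eq_bigr _ (fun t _ => E t)) exchange_big /= mulr_suml.
by apply: eq_bigr => X _; rewrite -mulr_sumr -mulrA.
Qed.

Lemma trig_poly_bound t : `|trig_poly t| <= \sum_x `|kappa x|.
Proof.
apply: le_trans (ler_norm_sum _ _ _) _; apply: ler_sum => x _.
rewrite normrM ler_piMr // ler_norml.
exact: (Re_chi_bound N_prime w_prim).
Qed.

End Expansion.

(** * Signed expansions in base [D] *)

Section Digits.
Variable D : int.
Hypothesis D_gt0 : 0 < D.

Lemma digits_bound n (x : 'I_n -> int) : (forall r, `|x r| < D) ->
  `|\sum_(r < n) D ^+ r * x r| < D ^+ n.
Proof.
elim: n x => [|n IHn] x xD; first by rewrite big_ord0 normr0 expr0.
rewrite big_ord_recr /=.
have := IHn (fun r => x (widen_ord (leqnSn n) r)) (fun r => xD _) => {}IHn.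
apply: le_lt_trans (ler_normD _ _) _.
have h : `|D ^+ n * x ord_max| <= D ^+ n * (D - 1).
  rewrite normrM ger0_norm ?exprn_ge0 ?(ltW D_gt0) // ler_pM2l ?exprn_gt0 //.
  by have := xD ord_max; lia.
apply: lt_le_trans (ltr_leD IHn h) _.
by rewrite exprS; lra.
Qed.

(** The lowest digit is a multiple of [D] of absolute value below [D], hence zero; dividing by [D]
    gives the induction. *)
Lemma digits_eq0 n (x : 'I_n -> int) : (forall r, `|x r| < D) ->
  \sum_(r < n) D ^+ r * x r = 0 -> forall r, x r = 0.
Proof.
elim: n x => [|n IHn] x xD; first by move=> _ [].
rewrite big_ord_recl expr0 mul1r => E.
have E' : x ord0 + D * (\sum_(r < n) D ^+ r * x (lift ord0 r)) = 0.
  rewrite -[RHS]E; congr (_ + _); rewrite mulr_sumr; apply: eq_bigr => r _.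
  by rewrite mulrA -exprS.
have x0 : x ord0 = 0.
  apply/eqP; apply: contraT => nz.
  have : (D %| x ord0)%Z.
    apply/dvdzP; exists (- \sum_(r < n) D ^+ r * x (lift ord0 r)); lra.
  move=> /dvdn_leq; rewrite absz_gt0 nz => /(_ isT).
  by have := xD ord0; lia.
move: E'; rewrite x0 add0r => /eqP; rewrite mulf_eq0 gt_eqF //= => /eqP E2 r.
case: (unliftP ord0 r) => [j ->|-> //].
exact: (IHn (fun r => x (lift ord0 r)) (fun r => xD _) E2).
Qed.

End Digits.

(** * Sign vectors and Riesz products *)

Section SignVectors.
Variable m : nat.

Definition signvec := {ffun 'I_m -> option bool}.

Definition sign_val (o : option bool) : int :=
  match o with None => 0 | Some b => if b then 1 else -1 end.

Definition zerovec : signvec := [ffun=> None].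
Definition oppvec (v : signvec) : signvec := [ffun r => omap negb (v r)].

Lemma oppvecK : involutive oppvec.
Proof. by move=> v; apply/ffunP => r; rewrite !ffunE; case: (v r) => [[]|]. Qed.

Lemma sign_val_opp (v : signvec) r : sign_val (oppvec v r) = - sign_val (v r).
Proof. by rewrite ffunE; case: (v r) => [[]|]. Qed.

Lemma oppvec_eq0 v : (oppvec v == zerovec) = (v == zerovec).
Proof.
rewrite -(inj_eq (inv_inj oppvecK)) oppvecK; congr (_ == _).
by apply/ffunP => r; rewrite !ffunE.
Qed.

Lemma sign_val_norm o : `|sign_val o| <= 1.
Proof. by case: o => [[]|]. Qed.

Lemma sign_val_inj : injective sign_val.
Proof. by case=> [[]|] [[]|]. Qed.

Lemma signvec_neq0 v : v != zerovec -> exists r, sign_val (v r) != 0.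
Proof.
move=> nz; apply/existsP; apply: contraR nz; rewrite negb_exists => /forallP H.
apply/eqP/ffunP => r; rewrite ffunE; apply: sign_val_inj.
by apply/eqP; have := H r; rewrite negbK.
Qed.

Definition encode (D : int) (v : signvec) : int := \sum_(r < m) D ^+ r * sign_val (v r).

Lemma encode_opp D v : encode D (oppvec v) = - encode D v.
Proof.
by rewrite /encode -sumrN; apply: eq_bigr => r _; rewrite sign_val_opp mulrN.
Qed.

(** The Fourier coefficient at [v] of the Riesz product [prod_r (1 + cos theta_r)]. *)
Definition vec_weight (R : realType) (v : signvec) : R :=
  \prod_r (if v r == None then 1 else 2^-1).

Lemma vec_weight_opp (R : realType) v : vec_weight R (oppvec v) = vec_weight R v.
Proof. by apply: eq_bigr => r _; rewrite ffunE; case: (v r). Qed.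

Lemma vec_weight_ge0 (R : realType) v : 0 <= vec_weight R v.
Proof. by apply: prodr_ge0 => r _; case: ifP => _; rewrite ?ler01 // invr_ge0 ler0n. Qed.

Lemma vec_weight_le1 (R : realType) v : vec_weight R v <= 1.
Proof.
apply: prodr_ile1 => r _; case: ifP => _; rewrite ?ler01 ?lexx // invr_ge0 ler0n /=.
by rewrite invf_le1 ?ltr0n // ler1n.
Qed.

Lemma vec_weight0 (R : realType) : vec_weight R zerovec = 1.
Proof. by rewrite /vec_weight big1 // => r _; rewrite ffunE. Qed.

Lemma sum_vec_weight (R : realType) (F : 'I_m -> option bool -> R) :
  \sum_(v : signvec) \prod_r F r (v r) = \prod_r \sum_o F r o.
Proof. by rewrite bigA_distr_bigA. Qed.

Lemma sum_option_bool (V : nmodType) (F : option bool -> V) :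
  \sum_o F o = F None + F (Some true) + F (Some false).
Proof.
rewrite (bigD1 None) //= (bigD1 (Some true)) //= (bigD1 (Some false)) //= big1 ?addr0 ?addrA //.
by case=> [[]|].
Qed.

Lemma total_vec_weight (R : realType) : \sum_(v : signvec) vec_weight R v = 2 ^+ m.
Proof.
rewrite /vec_weight (sum_vec_weight (fun _ o => if o == None then 1 else 2^-1)).
rewrite (eq_bigr (fun=> 2)) => [|r _]; first by rewrite prodr_const card_ord.
by rewrite sum_option_bool /=; lra.
Qed.

Variables (R : realType) (N : nat).
Hypothesis N_prime : prime N.
Variable w : complex R.
Hypothesis w_prim : N.-primitive_root w.

(** The sum factors over the coordinates. The values [1] and [-1] contribute conjugate halves, so
    the factor at [r] is [1 + Re (chi (D^r x))], which is nonnegative. *)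
Lemma weighted_character_sum_ge0 (D : int) (x : 'Z_N) :
  0 <= \sum_(v : signvec) vec_weight R v * complex.Re (chi w ((encode D v)%:~R * x)).
Proof.
pose F (r : 'I_m) (o : option bool) : complex R :=
  real_complex R (if o == None then 1 else 2^-1) * chi w ((D ^+ r * sign_val o)%:~R * x).
have -> : \sum_(v : signvec) vec_weight R v * complex.Re (chi w ((encode D v)%:~R * x)) =
    complex.Re (\sum_(v : signvec) \prod_r F r (v r)).
  rewrite Re_sum; apply: eq_bigr => v _; rewrite /F big_split /= -rmorph_prod -chi_sum //.
  by rewrite Re_realM -mulr_suml -rmorph_sum.
have -> : \sum_(v : signvec) \prod_r F r (v r) = \prod_r \sum_o F r o by rewrite bigA_distr_bigA.
rewrite (eq_bigr (fun r : 'I_m => real_complex R (1 + complex.Re (chi w ((D ^+ r)%:~R * x))))).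
  rewrite -rmorph_prod /=; apply: prodr_ge0 => r _.
  by have /andP [h _] := Re_chi_bound N_prime w_prim ((D ^+ r)%:~R * x); rewrite -lerBlDl sub0r.
move=> r _; rewrite sum_option_bool /F /= mulr0 mul0r chi0 mulr1.
rewrite mulr1 mulrN1 rmorphN mulNr -conj_chi //.
case: (chi w _) => a b; congr (Complex _ _); rewrite /=; lra.
Qed.

End SignVectors.

(** * Relations between the coefficients *)

(** The rational root theorem in homogeneous form: after division by the gcd, [y'] divides [x'^3]
    and is coprime to it, hence is a unit. *)
Lemma monic_cubic_rational_root (al be ga x y : int) : y != 0 ->
  x ^+ 3 + al * x ^+ 2 * y + be * x * y ^+ 2 + ga * y ^+ 3 = 0 ->
  exists z : int, z ^+ 3 + al * z ^+ 2 + be * z + ga = 0 /\ (`|z| %| `|ga|)%N.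
Proof.
move=> y0 E; pose g := gcdz x y.
have g0 : g != 0 by rewrite gcdz_eq0 negb_and y0 orbT.
have /dvdzP [x' Ex] : (g %| x)%Z by exact: dvdz_gcdl.
have /dvdzP [y' Ey] : (g %| y)%Z by exact: dvdz_gcdr.
have cop : coprimez x' y'.
  have := mulz_gcdl x' y' g; rewrite -Ex -Ey -/g => Eg.
  have gp : g = `|g|%:Z by rewrite /g /gcdz.
  rewrite /coprimez; apply/eqP/(mulIf g0); rewrite mul1r -{2}Eg.
  by rewrite -gp.
have E' : x' ^+ 3 + al * x' ^+ 2 * y' + be * x' * y' ^+ 2 + ga * y' ^+ 3 = 0.
  apply/eqP; rewrite -(mulrI_eq0 _ (mulfI (expf_neq0 3 g0))); apply/eqP.
  by rewrite -[RHS]E Ex Ey; ring.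
have dv : (y' %| x' ^+ 3)%Z.
  apply/dvdzP; exists (- (al * x' ^+ 2 + be * x' * y' + ga * y' ^+ 2)).
  by move/eqP: E'; rewrite -!addrA addr_eq0 => /eqP ->; ring.
have : (y' %| 1)%Z.
  by rewrite -(@Gauss_dvdzr y' (x' ^+ 3)) ?mulr1 // coprimez_sym coprimezXl.
rewrite dvdz1 => /eqP ny.
have [Ey1|Ey1] : y' = 1 \/ y' = -1 by clear -ny; lia.
  exists x'; split; first by rewrite -[RHS]E' Ey1; ring.
  apply/(@dvdzP x' ga); exists (- (x' ^+ 2 + al * x' + be)).
  by apply/eqP; rewrite -subr_eq0; apply/eqP; rewrite -[RHS]E' Ey1; ring.
exists (- x'); split.
  apply/eqP; rewrite -oppr_eq0; apply/eqP.
  by rewrite -[RHS]E' Ey1; ring.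
apply/(@dvdzP (- x') ga); exists (- (x' ^+ 2 - al * x' + be)).
by apply/eqP; rewrite -subr_eq0 -oppr_eq0; apply/eqP; rewrite -[RHS]E' Ey1; ring.
Qed.

(** A rational root [x / y] would produce an integer root dividing the constant term [-1] or [-2],
    and none of [0, 1, -1, 2, -2] is a root. *)
Lemma irrational_cubics (x y : int) : 0 < y ->
  [/\ x ^+ 3 <> x ^+ 2 * y + y ^+ 3,
      x ^+ 3 + x ^+ 2 * y <> x * y ^+ 2 + 2 * y ^+ 3
    & x ^+ 3 + 2 * x ^+ 2 * y <> 2 * y ^+ 3].
Proof.
move=> y_gt0; have y0 : y != 0 by rewrite gt_eqF.
have small (z : int) : (`|z| <= 2)%N -> z \in [:: 0; 1; -1; 2; -2].
  by case: z => [[|[|[|//]]]|[|[|//]]].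
have nosmall z (P : pred int) : (`|z| <= 2)%N -> P z -> [|| P 0, P 1, P (-1), P 2 | P (-2)].
  by move=> /small; rewrite !inE => /or4P [/eqP->|/eqP->|/eqP->|/orP [] /eqP->] ->; rewrite ?orbT.
split=> E.
- have [|z [Ez /dvdn_leq z1]] := @monic_cubic_rational_root (-1) 0 (-1) x y y0.
    by rewrite E; ring.
  have z2 : (`|z| <= 2)%N by apply: (leq_trans (z1 _)).
  by have := nosmall z (fun z => z ^+ 3 + -1 * z ^+ 2 + 0 * z + -1 == 0) z2 (introT eqP Ez).
- have [|z [Ez /dvdn_leq z1]] := @monic_cubic_rational_root 1 (-1) (-2) x y y0.
    by rewrite mul1r E; ring.
  have z2 : (`|z| <= 2)%N by apply: (leq_trans (z1 _)).
  by have := nosmall z (fun z => z ^+ 3 + 1 * z ^+ 2 + -1 * z + -2 == 0) z2 (introT eqP Ez).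
- have [|z [Ez /dvdn_leq z1]] := @monic_cubic_rational_root 2 0 (-2) x y y0.
    by rewrite E; ring.
  have z2 : (`|z| <= 2)%N by apply: (leq_trans (z1 _)).
  by have := nosmall z (fun z => z ^+ 3 + 2 * z ^+ 2 + 0 * z + -2 == 0) z2 (introT eqP Ez).
Qed.

(** * Coincidences involving two coefficients and two gaps *)

Section Accidents.
Variables a b c : int.
Hypothesis a_gt0 : 0 < a.
Hypothesis b_gt0 : 0 < b.
Hypothesis a_lt_c : a < c.

(** [p, q, r, s] are the absolute values of the third divided difference weights
    [1 / prod_(j != i) (k_i - k_j)] at the four positions, with denominators cleared. *)
Let p := b * c * (b + c).
Let q := c * (a + b) * (a + b + c).
Let r := a * (b + c) * (a + b + c).
Let s := a * b * (a + b).

(** The two distances in each of the three splittings of the four positions into two pairs, in both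
    orders. *)
Definition gap_pairs : seq (int * int) :=
  [:: (a, c); (c, a); (a + b, b + c); (b + c, a + b); (a + b + c, b); (b, a + b + c)].

Let X1 := b * c * (a + b) = a * (b + c) * (a + b + c).
Let X2 := a * (a + b) * (a + b + c) = b * c * (b + c).

(** An equation [p * x = q * y] is homogeneous of degree four. After [c = a + e] it is an equation
    in the positive quantities [a, b, e], and with all fifteen monomials known to be positive,
    linear arithmetic refutes it whenever the difference has a constant sign. *)
Lemma quartic_monomials_pos (x y z : int) : 0 < x -> 0 < y -> 0 < z ->
  [/\ [/\ 0 < x*x*x*x, 0 < x*x*x*y, 0 < x*x*x*z, 0 < x*x*y*y & 0 < x*x*y*z],
      [/\ 0 < x*x*z*z, 0 < x*y*y*y, 0 < x*y*y*z, 0 < x*y*z*z & 0 < x*z*z*z]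
    & [/\ 0 < y*y*y*y, 0 < y*y*y*z, 0 < y*y*z*z, 0 < y*z*z*z & 0 < z*z*z*z]].
Proof. by move=> x0 y0 z0; do !split; rewrite !mulr_gt0. Qed.

Ltac sign_definite :=
  let e := fresh "e" in
  have [e Ee e_gt0] : exists2 e, c = a + e & 0 < e
    by [exists (c - a); [rewrite addrC subrK | rewrite subr_gt0]];
  have := quartic_monomials_pos a_gt0 b_gt0 e_gt0;
  case=> [[? ? ? ? ?] [? ? ? ? ?] [? ? ? ? ?]]; subst c; lra.

Let c_gt0 : 0 < c. Proof. exact: lt_trans a_lt_c. Qed.

(** For each pair of characters most of the six gap pairs give a difference of constant sign because
    [a < c]. The others, after cancellation of a common factor, leave the coincidences named in the
    conclusion. *)
Lemma accident01 x y : (x, y) \in gap_pairs -> p * x = q * y ->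
  X2 \/ (a + b + c) * (a + b) ^+ 2 = b * (b + c) ^+ 2.
Proof.
rewrite /gap_pairs !inE !xpair_eqE /p /q /X2.
move=> /or4P [|||/or3P []] /andP [/eqP -> /eqP ->] E.
- by exfalso; sign_definite.
- by left; apply: (@mulfI _ c); [rewrite gt_eqF | lra].
- by exfalso; sign_definite.
- by right; apply: (@mulfI _ c); [rewrite gt_eqF | lra].
- by exfalso; sign_definite.
- by exfalso; sign_definite.
Qed.

Lemma accident03 x y : (x, y) \in gap_pairs -> p * x = s * y -> X2.
Proof.
rewrite /gap_pairs !inE !xpair_eqE /p /s /X2.
move=> /or4P [|||/or3P []] /andP [/eqP -> /eqP ->] E.
1-5: by exfalso; sign_definite.
by apply: (@mulfI _ b); [rewrite gt_eqF | lra].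
Qed.

Lemma accident12 x y : (x, y) \in gap_pairs -> q * x = r * y ->
  X1 \/ b ^+ 2 = a * c.
Proof.
rewrite /gap_pairs !inE !xpair_eqE /q /r /X1.
move=> /or4P [|||/or3P []] /andP [/eqP -> /eqP ->] E.
- by exfalso; sign_definite.
- by exfalso; sign_definite.
- right; apply: (@mulfI _ ((c - a) * (a + b + c))).
    by rewrite gt_eqF // mulr_gt0 ?subr_gt0 // !addr_gt0.
  lra.
- by exfalso; sign_definite.
- by exfalso; sign_definite.
- by left; apply: (@mulfI _ (a + b + c)); [rewrite gt_eqF // !addr_gt0 | lra].
Qed.

Lemma accident13 x y : (x, y) \in gap_pairs -> q * x = s * y -> False.
Proof.
rewrite /gap_pairs !inE !xpair_eqE /q /s.
move=> /or4P [|||/or3P []] /andP [/eqP -> /eqP ->] E; by sign_definite.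
Qed.

Lemma accident23 x y : (x, y) \in gap_pairs -> r * x = s * y -> X1.
Proof.
rewrite /gap_pairs !inE !xpair_eqE /r /s /X1.
move=> /or4P [|||/or3P []] /andP [/eqP -> /eqP ->] E.
- by apply: (@mulfI _ a); [rewrite gt_eqF | lra].
all: by exfalso; sign_definite.
Qed.

(** Combining the identities with factors [a + b] and [b + c] leaves
    [b c ((b + c)^2 - (a + b)^2) = 0], which forces [a = c]. *)
Lemma accident_X1_X2 : X1 -> X2 -> False.
Proof.
rewrite /X1 /X2 => E1 E2.
have : (b * c) * ((b + c) ^+ 2 - (a + b) ^+ 2) = 0.
  transitivity ((b + c) * (b * c * (b + c) - a * (a + b) * (a + b + c))
     + (a + b) * (a * (b + c) * (a + b + c) - b * c * (a + b))); first by ring.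
  by rewrite E1 E2 !subrr !mulr0 addr0.
move/eqP; rewrite mulf_eq0 gt_eqF ?mulr_gt0 //= subr_sqr mulf_eq0 => /orP [] /eqP E.
  by move: a_lt_c a_gt0 b_gt0; lra.
by move: a_lt_c a_gt0 b_gt0; lra.
Qed.

(* With [x = b + c] and [y = a + b] both coincidences force [x / y] to be a
   root of [t^3 = t^2 + 1]. *)
Lemma accident_X1_X4 : X1 -> (a + b + c) * (a + b) ^+ 2 = b * (b + c) ^+ 2 -> False.
Proof.
rewrite /X1 => E1 E4; set x := b + c; set y := a + b.
have y_gt0 : 0 < y by rewrite addr_gt0.
have xy : y < x by rewrite /x /y addrC ltrD2l.
have x_gt0 := lt_trans y_gt0 xy.
have E5 : c * y ^+ 3 = a * x ^+ 3.
  apply: (@mulfI _ b); first by rewrite gt_eqF.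
  transitivity ((b * c * (a + b)) * y ^+ 2); first by rewrite /y; ring.
  rewrite E1; transitivity (a * x * ((a + b + c) * (a + b) ^+ 2)).
    by rewrite /x /y; ring.
  by rewrite E4 /x; ring.
have E6 : a * (x ^+ 2 + x * y + y ^+ 2) = y ^+ 3.
  apply: (@mulfI _ (x - y)); first by rewrite subr_eq0 gt_eqF.
  transitivity (a * x ^+ 3 - a * y ^+ 3); first by ring.
  by rewrite -E5 /x /y; ring.
have E7 : a * (x ^+ 2 + y ^+ 2) = x * y * (x - y).
  transitivity (a * (x ^+ 2 + y ^+ 2) + (b * (b + c) ^+ 2 - (a + b + c) * (a + b) ^+ 2)).
    by rewrite E4 subrr addr0.
  by rewrite /x /y; ring.
have E8 : x ^+ 3 = x ^+ 2 * y + y ^+ 3.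
  apply: (@mulfI _ (a * y * (x + y))).
    by rewrite gt_eqF // !mulr_gt0 // addr_gt0.
  apply/eqP; rewrite -subr_eq0; apply/eqP.
  transitivity (a * (x * y * (x - y) * (x ^+ 2 + x * y + y ^+ 2) - y ^+ 3 * (x ^+ 2 + y ^+ 2))).
    by ring.
  by rewrite -E7 -E6; ring.
by have [] := irrational_cubics x y_gt0.
Qed.

(** With [x = b + c] and [y = a + b], the square relation gives [c y^2 = a x^2], hence
    [a (x + y) = y^2] and [b (x + y) = x y]. Inserted in [X2], these make [x / y] a root of
    [t^3 = t^2 + 1] once more. *)
Lemma accident_X2_square : X2 -> b ^+ 2 = a * c -> False.
Proof.
rewrite /X2 => E2 E3; set x := b + c; set y := a + b.
have y_gt0 : 0 < y by rewrite addr_gt0.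
have xy : y < x by rewrite /x /y addrC ltrD2l.
have x_gt0 := lt_trans y_gt0 xy.
have E5 : c * y ^+ 2 = a * x ^+ 2.
  apply/eqP; rewrite -subr_eq0; apply/eqP.
  transitivity ((c - a) * (b ^+ 2 - a * c)); first by rewrite /x /y; ring.
  by rewrite E3 subrr mulr0.
have E6 : a * (x + y) = y ^+ 2.
  apply: (@mulfI _ (x - y)); first by rewrite subr_eq0 gt_eqF.
  transitivity (a * x ^+ 2 - a * y ^+ 2); first by ring.
  by rewrite -E5 /x /y; ring.
have E7 : b * (x + y) = x * y.
  transitivity (y * (x + y) - a * (x + y)); first by rewrite /y; ring.
  by rewrite E6; ring.
have E8 : (a + b + c) * y ^+ 3 = b * x ^+ 3.
  apply: (@mulfI _ a); first by rewrite gt_eqF.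
  transitivity (a * (a + b) * (a + b + c) * y ^+ 2); first by rewrite /y; ring.
  rewrite E2; transitivity (b * x * (c * y ^+ 2)); first by rewrite /x; ring.
  by rewrite E5; ring.
have E9 : x ^+ 3 = x ^+ 2 * y + y ^+ 3.
  apply: (@mulfI _ (y * (x + y))).
    by rewrite gt_eqF // !mulr_gt0 // addr_gt0.
  apply/eqP; rewrite -subr_eq0; apply/eqP.
  transitivity (x * y * x ^+ 3 - (x * (x + y) + y ^+ 2) * y ^+ 3); first by ring.
  rewrite -E6 -E7.
  transitivity ((x + y) * (b * x ^+ 3 - (a + b + c) * y ^+ 3)); first by rewrite /x; ring.
  by rewrite E8 subrr mulr0.
by have [] := irrational_cubics x y_gt0.
Qed.

Definition abs_coef (i : 'I_4) : int := nth 0 [:: p; q; r; s] i.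

(** An accident uses two characters [i] and [j] twice each, so its product of amplitudes carries
    [eps^(2 (wt i + wt j))]. The exponent must exceed that of the main relation, for the accident to
    be smaller by a factor [eps]. *)
Lemma accident_weights : exists wt : 'I_4 -> nat, (forall i, wt i <= 1)%N /\
  forall i j : 'I_4, i != j -> forall x y, (x, y) \in gap_pairs ->
  abs_coef i * x = abs_coef j * y -> (\sum_(l < 4) wt l < 2 * (wt i + wt j))%N.
Proof.
have swap x y : (x, y) \in gap_pairs -> (y, x) \in gap_pairs.
  rewrite /gap_pairs !inE !xpair_eqE.
  by move=> /or4P [|||/or3P []] /andP [-> ->]; rewrite ?orbT.
(* Under [X1] every accident involves character 2, and under [X2] character 0, since the other
   coincidences are then excluded. Otherwise accidents only join two of the characters 0, 1, 2. Each
   choice of weights gives such pairs more than half of the total. *)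
pose wt : 'I_4 -> nat := fun i => nth 0%N
  (if b * c * (a + b) == a * (b + c) * (a + b + c) then [:: 0; 0; 1; 0]%N
   else if a * (a + b) * (a + b + c) == b * c * (b + c) then [:: 1; 0; 0; 0]%N
   else [:: 1; 1; 1; 0]%N) i.
exists wt; split.
  by move=> i; rewrite /wt; case: ifP => _; [|case: ifP => _]; case: i => [[|[|[|[|//]]]] ?].
have main (i j : 'I_4) x y : (i < j)%N -> (x, y) \in gap_pairs ->
  abs_coef i * x = abs_coef j * y -> (\sum_(l < 4) wt l < 2 * (wt i + wt j))%N.
  move=> ij xy; rewrite !big_ord_recl big_ord0 /abs_coef /wt.
  case: eqP => [E1|nE1]; [|case: eqP => [E2|nE2]];
   case: i j ij => [[|[|[|[|//]]]] ?] [[|[|[|[|//]]]] ?] //= _ E.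
  - by case: (accident01 xy E) => [/(accident_X1_X2 E1)|/(accident_X1_X4 E1)].
  - by case: (accident_X1_X2 E1 (accident03 xy E)).
  - by case: (accident13 xy E).
  - by case: (accident12 xy E) => // /(accident_X2_square E2).
  - by case: (accident13 xy E).
  - by case: nE1; exact: accident23 xy E.
  - by case: nE2; exact: accident03 xy E.
  - by case: (accident13 xy E).
  - by case: nE1; exact: accident23 xy E.
move=> i j nij x y xy E; case: (ltngtP i j) => ij.
- exact: (main _ _ _ _ ij xy E).
- by rewrite [(wt i + _)%N]addnC; exact: (main _ _ _ _ ij (swap _ _ xy) (esym E)).
- by move: nij; rewrite (val_inj ij) eqxx.
Qed.

End Accidents.

Lemma two_pairs_match (T : eqType) (x y z w : T) :
  (forall u, (x == u) + (y == u) = (z == u) + (w == u))%N ->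
  (x = z /\ y = w) \/ (x = w /\ y = z).
Proof.
move=> H; have := H x; have := H y; rewrite !eqxx.
have [-> |nzx] := eqVneq z x; first last.
  have [->|_] := eqVneq w x; last by lia.
  by have [-> |] := eqVneq z y; [right|lia].
by have [-> |] := eqVneq w y; [left|have [->|] := eqVneq x y; lia].
Qed.

Lemma balanced_signs (t0 t1 t2 t3 : int) :
  `|t0| <= 1 -> `|t1| <= 1 -> `|t2| <= 1 -> `|t3| <= 1 ->
  t0 + t1 + t2 + t3 = 0 ->
  (t0, t1, t2, t3) \in [:: (0, 0, 0, 0);
    (1, -1, 0, 0); (-1, 1, 0, 0); (1, 0, -1, 0); (-1, 0, 1, 0);
    (1, 0, 0, -1); (-1, 0, 0, 1); (0, 1, -1, 0); (0, -1, 1, 0);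
    (0, 1, 0, -1); (0, -1, 0, 1); (0, 0, 1, -1); (0, 0, -1, 1);
    (1, 1, -1, -1); (1, -1, 1, -1); (1, -1, -1, 1);
    (-1, 1, 1, -1); (-1, 1, -1, 1); (-1, -1, 1, 1)].
Proof.
move=> h0 h1 h2 h3 E.
have [?|[?|?]] : t0 = -1 \/ t0 = 0 \/ t0 = 1 by lia.
all: have [?|[?|?]] : t1 = -1 \/ t1 = 0 \/ t1 = 1 by lia.
all: have [?|[?|?]] : t2 = -1 \/ t2 = 0 \/ t2 = 1 by lia.
all: have : t3 = - (t0 + t1 + t2) by lia.
all: by subst => ?; subst; move: h3.
Qed.

(** * Sign patterns whose characters cancel *)

Section SignPatterns.
Variables (T : eqType) (C : T -> int) (a b c : int).
Hypothesis C_neq0 : forall u, C u != 0.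
Hypotheses (a_gt0 : 0 < a) (b_gt0 : 0 < b) (c_gt0 : 0 < c) (a_neq_c : a != c).

Definition gap_distances (z1 z2 : int) :=
  exists2 xy, xy \in gap_pairs a b c & `|z1| = xy.1 /\ `|z2| = xy.2.

Lemma gap_distancesP (z1 z2 x y : int) : (x, y) \in gap_pairs a b c ->
  z1 = x \/ z1 = - x -> z2 = y \/ z2 = - y -> gap_distances z1 z2.
Proof.
move=> xy h1 h2; exists (x, y) => //=.
have [x_gt0 y_gt0] : 0 < x /\ 0 < y.
  move: xy; rewrite /gap_pairs !inE !xpair_eqE.
  by move=> /or4P [|||/or3P []] /andP [/eqP -> /eqP ->]; split; rewrite ?addr_gt0.
by case: h1 => ->; case: h2 => ->; rewrite ?normrN !gtr0_norm.
Qed.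

Ltac two_signs two H x y kx ky :=
  let K := fresh "K" in let u := fresh "u" in
  exfalso; have K : kx = ky;
  [ apply: (@two x y);
    [ move=> u; move: (H u); case: (x == u); case: (y == u); rewrite ?if_same // | lra ]
  | move: a_gt0 b_gt0 c_gt0; lra ].

Ltac gap_pair x y := apply: (@gap_distancesP _ _ x y);
  [ by rewrite /gap_pairs !inE !eqxx ?orbT
  | by first [ left; ring | right; ring ] | by first [ left; ring | right; ring ] ].

Ltac four_signs four H x y z w kx ky kz kw :=
  let u := fresh "u" in let v := fresh "v" in let uv := fresh "uv" in
  let e1 := fresh "e" in let e2 := fresh "e" in
  right; split=> //;
  have [||||| u [v [uv e1 e2]]] := @four x y z w kx ky kz kw;
  [ move=> u; move: (H u);
    by case: (x == u); case: (y == u); case: (z == u); case: (w == u)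
  | lra
  | move/eqP: a_neq_c; move: a_gt0 b_gt0 c_gt0; lra
  | first [ gap_pair a c | gap_pair c a | gap_pair (a + b) (b + c)
          | gap_pair (b + c) (a + b) | gap_pair (a + b + c) b | gap_pair b (a + b + c) ]
  | first [ gap_pair a c | gap_pair c a | gap_pair (a + b) (b + c)
          | gap_pair (b + c) (a + b) | gap_pair (a + b + c) b | gap_pair b (a + b + c) ]
  | exists u, v; split=> // f; rewrite -e2; lia ].

(** Two nonzero signs would carry the same character at two positions, and the moment equation would
    identify these positions. With four, each positive character equals a negative one, and the
    moment equation compares the two distances of a splitting of the positions. *)
Lemma vanishing_sign_pattern (x0 x1 x2 x3 : T) (t0 t1 t2 t3 : int) :
  `|t0| <= 1 -> `|t1| <= 1 -> `|t2| <= 1 -> `|t3| <= 1 ->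
  t0 + t1 + t2 + t3 = 0 ->
  (forall u, (if x0 == u then t0 else 0) + (if x1 == u then t1 else 0) +
             (if x2 == u then t2 else 0) + (if x3 == u then t3 else 0) = 0) ->
  t1 * C x1 * a + t2 * C x2 * (a + b) + t3 * C x3 * (a + b + c) = 0 ->
  [/\ t0 = 0, t1 = 0, t2 = 0 & t3 = 0] \/
  [/\ [/\ t0 != 0, t1 != 0, t2 != 0 & t3 != 0] &
    exists u v, [/\ u != v,
      exists2 xy, xy \in gap_pairs a b c & `|C u| * xy.1 = `|C v| * xy.2 &
      forall f : T -> nat, (f x0 + f x1 + f x2 + f x3 = 2 * (f u + f v))%N]].
Proof.
move=> h0 h1 h2 h3 St H E.
have C_eq0 (u : T) (z : int) : C u * z = 0 -> z = 0.
  by move/eqP; rewrite mulf_eq0 (negbTE (C_neq0 u)) => /eqP.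
have two (x y : T) (z1 z2 : int) : (forall u, (x == u) = (y == u)) ->
    C x * z1 = C y * z2 -> z1 = z2.
  move=> /(_ x); rewrite eqxx => /esym /eqP -> Ez.
  by apply/eqP; rewrite -subr_eq0; apply/eqP/(@C_eq0 x); rewrite mulrBr Ez subrr.
have four (x y z w : T) (kx ky kz kw : int) :
    (forall u, (x == u) + (y == u) = (z == u) + (w == u))%N ->
    C x * kx + C y * ky = C z * kz + C w * kw ->
    kx + ky <> kz + kw -> gap_distances (kx - kz) (ky - kw) -> gap_distances (kx - kw) (ky - kz) ->
    exists u v, [/\ u != v,
      exists2 xy, xy \in gap_pairs a b c & `|C u| * xy.1 = `|C v| * xy.2 &
      forall f : T -> nat, (f x + f y + f z + f w = 2 * (f u + f v))%N].
  move=> Hu Ez nk g1 g2; exists x, y.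
  (* If the two positive characters agree, all four do, and the position sums of the two sides are
     equal. For the splitting of positions 0, 3 against 1, 2 this reads [a = c]: the place where the
     excluded case enters. *)
  have nxy : x != y.
    apply/eqP => xy; move: Ez nk; have := two_pairs_match Hu; rewrite -xy.
    move=> [] [<- <-] Ez []; apply/eqP; rewrite -subr_eq0; apply/eqP/(@C_eq0 x).
      by lra.
    by lra.
  have [[Ex Ey]|[Ex Ey]] := two_pairs_match Hu; split=> //.
  - case: g1 => xy gxy [G1 G2]; exists xy => //; rewrite -G1 -G2 -!normrM.
    by rewrite -[LHS]normrN; congr `|_|; move: Ez; rewrite -Ex -Ey; lra.
  - by move=> f; rewrite Ex Ey; lia.
  - case: g2 => xy gxy [G1 G2]; exists xy => //; rewrite -G1 -G2 -!normrM.
    by rewrite -[LHS]normrN; congr `|_|; move: Ez; rewrite -Ex -Ey; lra.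
  - by move=> f; rewrite Ex Ey; lia.
have := balanced_signs h0 h1 h2 h3 St.
rewrite !inE !xpair_eqE -!andbA.
move=> /orP [|/orP [|/orP [|/orP [|/orP [|/orP [|/orP [|/orP [|/orP [|/orP [|/orP [|/orP [|/orP [|/orP [|/orP [|/orP [|/orP [|/orP [|]]]]]]]]]]]]]]]]]] /and4P [/eqP T0 /eqP T1 /eqP T2 /eqP T3]; first by left.
all: move: H E; rewrite T0 T1 T2 T3 => H E.
- by two_signs two H x0 x1 (0 : int) a.
- by two_signs two H x1 x0 a (0 : int).
- by two_signs two H x0 x2 (0 : int) (a + b).
- by two_signs two H x2 x0 (a + b) (0 : int).
- by two_signs two H x0 x3 (0 : int) (a + b + c).
- by two_signs two H x3 x0 (a + b + c) (0 : int).
- by two_signs two H x1 x2 a (a + b).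
- by two_signs two H x2 x1 (a + b) a.
- by two_signs two H x1 x3 a (a + b + c).
- by two_signs two H x3 x1 (a + b + c) a.
- by two_signs two H x2 x3 (a + b) (a + b + c).
- by two_signs two H x3 x2 (a + b + c) (a + b).
- by four_signs four H x0 x1 x2 x3 (0 : int) a (a + b) (a + b + c).
- by four_signs four H x0 x2 x1 x3 (0 : int) (a + b) a (a + b + c).
- by four_signs four H x0 x3 x1 x2 (0 : int) (a + b + c) a (a + b).
- by four_signs four H x1 x2 x0 x3 a (a + b) (0 : int) (a + b + c).
- by four_signs four H x1 x3 x0 x2 a (a + b + c) (0 : int) (a + b).
- by four_signs four H x2 x3 x0 x1 (a + b) (a + b + c) (0 : int) a.
Qed.
End SignPatterns.

Local Notation o0 := (@Ordinal 4 0 isT).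
Local Notation o1 := (@Ordinal 4 1 isT).
Local Notation o2 := (@Ordinal 4 2 isT).
Local Notation o3 := (@Ordinal 4 3 isT).

Lemma sum4 (V : nmodType) (F : 'I_4 -> V) :
  \sum_(i < 4) F i = F o0 + F o1 + F o2 + F o3.
Proof.
rewrite !big_ord_recl big_ord0 addr0 !addrA.
by do ![congr (_ + _)]; congr F; apply: val_inj.
Qed.

Lemma sum4n (F : 'I_4 -> nat) :
  (\sum_(i < 4) F i = F o0 + F o1 + F o2 + F o3)%N.
Proof.
rewrite !big_ord_recl big_ord0 addn0 !addnA.
by do ![congr (_ + _)%N]; congr F; apply: val_inj.
Qed.

Lemma ord4P (x : 'I_4) : [\/ x = o0, x = o1, x = o2 | x = o3].
Proof.
case: x => [[|[|[|[|//]]]] ?];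
  [constructor 1|constructor 2|constructor 3|constructor 4]; exact: val_inj.
Qed.

(** Character [o1] carries the minus sign and [o3] the Riesz weight, so these must occur exactly
    once. Being a permutation would be too strong a requirement: in the coincident case characters 0
    and 2 have the same frequency and can replace each other. *)
Definition good_assignment (wt : 'I_4 -> nat) (sg : 'I_4 -> 'I_4) : Prop :=
  [/\ \sum_(i < 4) (sg i == o1) = 1, \sum_(i < 4) (sg i == o3) = 1
    & \sum_(i < 4) wt (sg i) = \sum_(i < 4) wt i]%N.

(** All that the analytic part needs from the positions. In the last clause [t] is one coordinate of
    the four sign vectors, with [0] for a slot that is empty there. A relation is then a copy of the
    main one or is smaller by a factor [eps]. *)
Definition local_data (k c lam : 'I_4 -> int) (wt : 'I_4 -> nat) : Prop :=
  [/\ [/\ injective k, (forall s, c s != 0) & (forall s, wt s <= 1)%N],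
      (forall s s', `|c s| = `|c s'| -> c s = c s' /\ lam s = lam s'),
      [/\ \sum_i c i = 0, \sum_i c i * k i = 0, \sum_i c i * k i ^+ 2 = 0,
          \sum_i lam i = 0 & \sum_i lam i * k i = 0]
    & forall (sg : 'I_4 -> 'I_4) (t : 'I_4 -> int),
      (forall i, `|t i| <= 1) -> (exists i, t i != 0) ->
      \sum_i t i * c (sg i) = 0 -> \sum_i t i * c (sg i) * k i = 0 ->
      \sum_i t i * lam (sg i) = 0 ->
      ((forall i j, t i = t j) /\ good_assignment wt sg) \/
      ((forall i, t i != 0) /\ (\sum_(i < 4) wt i < \sum_(i < 4) wt (sg i))%N)].

Section ClassSums.
Variables (I J : finType) (x : I -> J) (t : I -> int).

Definition class_sum (s : J) : int := \sum_i (if x i == s then t i else 0).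

Lemma class_sumE (F : J -> int) : \sum_i t i * F (x i) = \sum_s class_sum s * F s.
Proof.
rewrite /class_sum; under [RHS]eq_bigr => s _ do rewrite mulr_suml.
rewrite exchange_big /=; apply: eq_bigr => i _.
rewrite (bigD1 (x i)) //= eqxx big1 ?addr0 // => s /negbTE.
by rewrite eq_sym => ->; rewrite mul0r.
Qed.

Lemma class_sum_total : \sum_s class_sum s = \sum_i t i.
Proof.
rewrite (eq_bigr (fun s => class_sum s * 1)) => [|s _]; last by rewrite mulr1.
by rewrite -(class_sumE (fun=> 1)); apply: eq_bigr => i _; rewrite mulr1.
Qed.

Lemma class_sum_bound : \sum_s `|class_sum s| <= \sum_i `|t i|.
Proof.
rewrite /class_sum; apply: (@le_trans _ _ (\sum_s \sum_i `|if x i == s then t i else 0|)).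
  by apply: ler_sum => s _; exact: ler_norm_sum.
rewrite exchange_big /=; apply: ler_sum => i _.
rewrite (bigD1 (x i)) //= eqxx big1 ?addr0 // => s /negbTE.
by rewrite eq_sym => ->; rewrite normr0.
Qed.

End ClassSums.

(** Every character has a nonzero class sum, hence is attained; a surjection of four points is a
    permutation. *)
Lemma constant_class_sums (wt : 'I_4 -> nat) (sg : 'I_4 -> 'I_4) (t : 'I_4 -> int) (v : int) :
  v != 0 -> (forall s, class_sum sg t s = v) ->
  (forall i, t i = v) /\ good_assignment wt sg.
Proof.
move=> v0 H.
have surj s : exists i, sg i == s.
  apply/existsP; rewrite -[X in is_true X]negbK negb_exists; apply: contra v0 => /forallP nS.
  by rewrite -(H s) /class_sum big1 // => i _; rewrite (negbTE (nS i)).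
have inj : injective sg.
  have : codom sg =i 'I_4.
    move=> s; rewrite inE; have [i /eqP <-] := surj s; exact: codom_f.
  move/eq_card => Ecard; apply/injectiveP/card_uniqP.
  by rewrite Ecard size_map -cardE.
split=> [i|].
  have := H (sg i); rewrite /class_sum (bigD1 i) //= eqxx big1 ?addr0 // => j nji.
  by rewrite (inj_eq inj) (negbTE nji).
have re (f : 'I_4 -> nat) : (\sum_(i < 4) f (sg i) = \sum_(i < 4) f i)%N.
  by rewrite [RHS](reindex_inj inj).
split; first by rewrite (re (fun s => s == o1 : nat)) sum4n.
  by rewrite (re (fun s => s == o3 : nat)) sum4n.
exact: re.
Qed.

(** * Local data in the generic case *)

Section GenericData.
Variables a b c : int.
Hypotheses (a_gt0 : 0 < a) (b_gt0 : 0 < b) (a_lt_c : a < c).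

(** The equations say that [e] is an affine function of the position: its increments are
    proportional to the gaps. If it is not constant it is strictly monotone; four such integers of
    total size at most 4 are consecutive, so [a = b = c], contrary to [a < c]. *)
Lemma affine_small_vector (e0 e1 e2 e3 : int) :
  - (b * c * (b + c)) * e0 + c * (a + b) * (a + b + c) * e1
    - a * (b + c) * (a + b + c) * e2 + a * b * (a + b) * e3 = 0 ->
  b * e0 - (a + b) * e1 + a * e2 = 0 ->
  `|e0| + `|e1| + `|e2| + `|e3| <= 4 ->
  [/\ e1 = e0, e2 = e0 & e3 = e0].
Proof.
move=> E1 E2 small.
have c_gt0 := lt_trans a_gt0 a_lt_c.
have F1 : b * (e1 - e0) = a * (e2 - e1) by lra.
have F2 : b * (e3 - e2) = c * (e2 - e1).
  apply: (@mulfI _ (a * (a + b))); first by rewrite gt_eqF // mulr_gt0 // addr_gt0.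
  apply/eqP; rewrite -subr_eq0; apply/eqP; rewrite -[RHS]E1.
  have -> : e0 = e1 - (e1 - e0) by ring.
  set f := e1 - e0 in F1 *.
  transitivity (- (b * c * (b + c)) * e1 + c * (b + c) * (b * f) + c * (a + b) * (a + b + c) * e1
    - a * (b + c) * (a + b + c) * e2 + a * b * (a + b) * e3); last by ring.
  by rewrite F1; ring.
have [E|[P|P]] : e2 - e1 = 0 \/ 0 < e2 - e1 \/ e2 - e1 < 0 by lia.
- have z1 : e1 - e0 = 0 by apply: (@mulfI _ b); rewrite ?gt_eqF // F1 E !mulr0.
  have z2 : e3 - e2 = 0 by apply: (@mulfI _ b); rewrite ?gt_eqF // F2 E !mulr0.
  by split; lra.
- have z1 : 0 < e1 - e0 by rewrite -(pmulr_rgt0 _ b_gt0) F1 mulr_gt0.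
  have z2 : 0 < e3 - e2 by rewrite -(pmulr_rgt0 _ b_gt0) F2 mulr_gt0.
  have [G1 G2 G3] : [/\ e1 - e0 = 1, e2 - e1 = 1 & e3 - e2 = 1].
    by clear -z1 z2 P small; split; lia.
  by move: F1 F2 a_lt_c; rewrite G1 G2 G3; lra.
- have z1 : e1 - e0 < 0 by rewrite -(pmulr_rlt0 _ b_gt0) F1 pmulr_rlt0.
  have z2 : e3 - e2 < 0 by rewrite -(pmulr_rlt0 _ b_gt0) F2 pmulr_rlt0.
  have [G1 G2 G3] : [/\ e1 - e0 = -1, e2 - e1 = -1 & e3 - e2 = -1].
    by clear -z1 z2 P small; split; lia.
  by move: F1 F2 a_lt_c; rewrite G1 G2 G3; lra.
Qed.

End GenericData.

Definition positions (a b c : int) (i : 'I_4) : int :=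
  nth 0 [:: 0; a; a + b; a + b + c] i.

Lemma positions_inj a b c : 0 < a -> 0 < b -> 0 < c -> injective (positions a b c).
Proof.
move=> a_gt0 b_gt0 c_gt0 i j; rewrite /positions.
by case: (ord4P i) => ->; case: (ord4P j) => -> //= H; exfalso; move: H; lra.
Qed.

Section GenericLocalData.
Variables a b c : int.
Hypotheses (a_gt0 : 0 < a) (b_gt0 : 0 < b) (a_lt_c : a < c).
Hypothesis not_coincident : b * c != a * (a + b + c).

(** The third divided difference at the four positions, with denominators cleared and signs
    restored; it annihilates [1, k, k^2]. *)
Let cf (i : 'I_4) : int := nth 0 [:: - (b * c * (b + c)); c * (a + b) * (a + b + c);
  - (a * (b + c) * (a + b + c)); a * b * (a + b)] i.
(** The second divided difference at the first three positions. It annihilates [1] and [k] but not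
    [k^2], so the common kernel of [cf] and [lm] consists of the affine functions. *)
Let lm (i : 'I_4) : int := nth 0 [:: b; - (a + b); a; 0] i.

Lemma generic_local_data : exists wt, local_data (positions a b c) cf lm wt.
Proof.
have c_gt0 := lt_trans a_gt0 a_lt_c.
have [wt [wt1 wtP]] := accident_weights a_gt0 b_gt0 a_lt_c.
have ab_gt0 : 0 < a + b by rewrite addr_gt0.
have bc_gt0 : 0 < b + c by rewrite addr_gt0.
have abc_gt0 : 0 < a + b + c by rewrite addr_gt0.
have p_gt0 : 0 < b * c * (b + c) by rewrite !mulr_gt0.
have q_gt0 : 0 < c * (a + b) * (a + b + c) by rewrite !mulr_gt0.
have r_gt0 : 0 < a * (b + c) * (a + b + c) by rewrite !mulr_gt0.
have s_gt0 : 0 < a * b * (a + b) by rewrite !mulr_gt0.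
have abs_cf i : `|cf i| = abs_coef a b c i.
  by case: (ord4P i) => ->; rewrite /cf /abs_coef /= ?normrN gtr0_norm.
have cf0 i : cf i != 0.
  by rewrite -normr_gt0 abs_cf; case: (ord4P i) => ->; rewrite /abs_coef.
have lt_bc : a * b < b * c by rewrite mulrC ltr_pM2l.
have pq : b * c * (b + c) < c * (a + b) * (a + b + c).
  rewrite -subr_gt0.
  have -> : c * (a + b) * (a + b + c) - b * c * (b + c) = a * c * (a + b + c) + a * b * c by ring.
  by rewrite addr_gt0 // !mulr_gt0.
have sp : a * b * (a + b) < b * c * (b + c).
  rewrite -subr_gt0.
  have -> : b * c * (b + c) - a * b * (a + b) = b * (c - a) * (a + b + c) by ring.
  by rewrite !mulr_gt0 // subr_gt0.
have rq : a * (b + c) * (a + b + c) < c * (a + b) * (a + b + c).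
  rewrite -subr_gt0.
  have -> : c * (a + b) * (a + b + c) - a * (b + c) * (a + b + c) = b * (c - a) * (a + b + c) by ring.
  by rewrite !mulr_gt0 // subr_gt0.
have sr : a * b * (a + b) < a * (b + c) * (a + b + c).
  rewrite -subr_gt0.
  have -> : a * (b + c) * (a + b + c) - a * b * (a + b) = a * b * c + a * c * (a + b + c) by ring.
  by rewrite addr_gt0 // !mulr_gt0.
(* All other comparisons of magnitudes follow from [a < c]; equality here is exactly the coincident
   case. *)
have pr : b * c * (b + c) != a * (b + c) * (a + b + c).
  apply: contra not_coincident => /eqP E; apply/eqP.
  by apply: (@mulfI _ (b + c)); [rewrite gt_eqF | lra].
exists wt; split.
- by split=> //; exact: positions_inj.
- move=> i j; rewrite !abs_cf /abs_coef.
  case: (ord4P i) => ->; case: (ord4P j) => -> //= E; exfalso; move: E;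
    first [ by apply/eqP; rewrite eq_sym lt_eqF // ?(lt_trans sp pq)
          | by apply/eqP; rewrite lt_eqF // ?(lt_trans sp pq)
          | by apply/eqP
          | by apply/eqP; rewrite eq_sym ].
- by rewrite !sum4 /cf /lm /positions /=; split; ring.
move=> sg t t1 [i0 ti0] E1 E2 E3.
pose e := class_sum sg t.
have e_bound : `|e o0| + `|e o1| + `|e o2| + `|e o3| <= 4.
  rewrite -(sum4 (fun s => `|e s|)); apply: le_trans (class_sum_bound sg t) _.
  by rewrite sum4; move: (t1 o0) (t1 o1) (t1 o2) (t1 o3); lra.
have [|||H1 H2 H3] := @affine_small_vector a b c a_gt0 b_gt0 a_lt_c (e o0) (e o1) (e o2) (e o3).
- by rewrite -[RHS]E1 (class_sumE sg t cf) -/e sum4 /cf /=; ring.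
- by rewrite -[RHS]E3 (class_sumE sg t lm) -/e sum4 /lm /=; ring.
- exact: e_bound.
have eE s : e s = e o0 by case: (ord4P s) => ->.
have [e0|e0] := eqVneq (e o0) 0; last first.
  have [tE gs] := constant_class_sums wt e0 eE; left; split=> // i j.
  by rewrite !tE.
have H u : (if sg o0 == u then t o0 else 0) + (if sg o1 == u then t o1 else 0) +
      (if sg o2 == u then t o2 else 0) + (if sg o3 == u then t o3 else 0) = 0.
  by rewrite -(sum4 (fun i => if sg i == u then t i else 0)) -[LHS]/(e u) eE e0.
have St : t o0 + t o1 + t o2 + t o3 = 0.
  by rewrite -sum4 -(class_sum_total sg t) big1 // => s _; rewrite -/(e s) eE e0.
have ac : a != c by rewrite lt_eqF.
have E2' : t o1 * cf (sg o1) * a + t o2 * cf (sg o2) * (a + b) +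
     t o3 * cf (sg o3) * (a + b + c) = 0.
  by rewrite -[RHS]E2 sum4 /positions /=; ring.
have := vanishing_sign_pattern cf0 a_gt0 b_gt0 c_gt0 ac (t1 o0) (t1 o1) (t1 o2) (t1 o3) St H E2'.
case=> [[z0 z1 z2 z3]|[[z0 z1 z2 z3] [u [v [uv [xy gxy Exy] Wt]]]]].
  by exfalso; move: ti0; case: (ord4P i0) => ->; rewrite ?z0 ?z1 ?z2 ?z3 eqxx.
right; split; first by move=> i; case: (ord4P i) => ->.
rewrite [X in (_ < X)%N]sum4n Wt; apply: (wtP _ _ uv xy.1 xy.2).
  by rewrite -surjective_pairing.
by rewrite -!abs_cf.
Qed.

End GenericLocalData.

(* The discriminant of the quadratic form is [l^2 - m^2], and no triple
   [z^2 + m^2 = l^2] with [m, z != 0] has [l <= 4]. *)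
Lemma small_isotropic_form (a b m l : int) : 0 < a -> a < b ->
  `|m| <= 4 -> `|l| <= 4 -> m * (a ^+ 2 + b ^+ 2) + 2 * l * (a * b) = 0 ->
  m = 0 /\ l = 0.
Proof.
move=> a_gt0 a_lt_b m4 l4 E; have b_gt0 := lt_trans a_gt0 a_lt_b.
have [m0|m0] := eqVneq m 0.
  split=> //; move: E; rewrite m0 => E.
  by apply: (@mulfI _ (2 * (a * b))); [rewrite gt_eqF // !mulr_gt0 | lra].
exfalso.
have E2 : (m * a + l * b) ^+ 2 = (l ^+ 2 - m ^+ 2) * b ^+ 2.
  apply/eqP; rewrite -subr_eq0; apply/eqP.
  by transitivity (m * (m * (a ^+ 2 + b ^+ 2) + 2 * l * (a * b))); [ring | rewrite E mulr0].
have lm : 0 <= l ^+ 2 - m ^+ 2.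
  by rewrite -(pmulr_lge0 _ (exprn_gt0 2 b_gt0)) -E2 sqr_ge0.
pose X := absz (m * a + l * b); pose Y := absz b; pose D := absz (l ^+ 2 - m ^+ 2).
have EXY : (X ^ 2 = D * Y ^ 2)%N.
  by rewrite /X /Y /D -!abszX -abszM E2.
have Y0 : (0 < Y)%N by rewrite /Y absz_gt0 gt_eqF.
have /dvdnP [z Ez] : (Y %| X)%N by rewrite -(@dvdn_pexp2r _ _ 2) // EXY dvdn_mull.
have EzD : (z ^ 2 = D)%N.
  by apply/eqP; rewrite -(eqn_pmul2r (_ : 0 < Y ^ 2)%N) ?expn_gt0 ?Y0 // -expnMn -Ez EXY.
have Epyth : (z ^ 2 + `|m| ^ 2 = `|l| ^ 2)%N.
  rewrite EzD /D -!abszX; move: lm; clear; move: (l ^+ 2) (m ^+ 2) (sqr_ge0 l) (sqr_ge0 m).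
  by lia.
have [z0|z0] := posnP z.
  have : m * a + l * b = 0.
    by apply/eqP; rewrite -absz_eq0 -/X Ez z0.
  have : `|m|%N = `|l|%N.
    by move: Epyth; rewrite z0 add0n => /eqP; rewrite eqn_exp2r // => /eqP.
  have : (`|m| != 0)%N by rewrite absz_eq0.
  move: a_gt0 a_lt_b; clear; case: (ltrgtP m 0); case: (ltrgtP l 0); nia.
move: Epyth z0; have : (`|m| <= 4)%N by lia.
have : (`|l| <= 4)%N by lia.
have : (0 < `|m|)%N by rewrite absz_gt0.
move: (`|m|)%N (`|l|)%N => m' l' h1 h2 h3 E3 z0.
have : (z <= 4)%N.
  rewrite -(@leq_exp2r _ _ 2) //; apply: (@leq_trans (l' ^ 2)).
    by rewrite -E3 leq_addr.
  by rewrite leq_exp2r.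
move: E3 z0 h1 h2 h3; clear.
by case: z => [|[|[|[|[|//]]]]]; case: m' => [|[|[|[|[|//]]]]]; case: l' => [|[|[|[|[|//]]]]].
Qed.

(** * Local data when the coefficients at positions 0 and 2 agree *)

Section CoincidentLocalData.
Variables a b c : int.
Hypotheses (a_gt0 : 0 < a) (b_gt0 : 0 < b) (a_lt_c : a < c).
Hypothesis coincident : b * c = a * (a + b + c).

(** The annihilating vector rescaled: the coincidence gives [(b - a) c = a (a + b)], which allows
    the entries to be written in [a] and [b] only. *)
Let cf (i : 'I_4) : int :=
  nth 0 [:: - (a ^+ 2 + b ^+ 2); (a + b) ^+ 2; - (a ^+ 2 + b ^+ 2); (b - a) ^+ 2] i.

Let c_gt0 : 0 < c. Proof. exact: lt_trans a_lt_c. Qed.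

Lemma coincident_a_lt_b : a < b.
Proof.
rewrite ltNge; apply/negP => ba.
have : b * c <= a * c by rewrite ler_pM2r.
have := mulr_gt0 a_gt0 a_gt0; have := mulr_gt0 a_gt0 b_gt0.
by rewrite coincident; lra.
Qed.

Let a_lt_b := coincident_a_lt_b.

(** With [b = a + f] and [c f = a (2 a + f)], multiplication by [f] turns every equation into one
    between forms in the positive integers [a, f]. All but one have a constant sign; the last one is
    the cubic [f^3 + 2 f^2 a = 2 a^3]. *)
Lemma coincident_gap_ratios (x y : int) : (x, y) \in gap_pairs a b c ->
  [/\ x <> y, (a ^+ 2 + b ^+ 2) * x <> (a + b) ^+ 2 * y,
      (a ^+ 2 + b ^+ 2) * x <> (b - a) ^+ 2 * y
    & (a + b) ^+ 2 * x <> (b - a) ^+ 2 * y].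
Proof.
have [f Ef f_gt0] : exists2 f, b = a + f & 0 < f.
  by exists (b - a); [rewrite addrC subrK | rewrite subr_gt0].
have Hc : c * f = a * (2 * a + f) by move: coincident; rewrite Ef; lra.
have scale (u v z1 z2 : int) : u * z1 = v * z2 -> u * (z1 * f) = v * (z2 * f).
  by move=> E; rewrite !mulrA E.
have mono : [/\ 0 < a*a*a*a, 0 < a*a*a*f, 0 < a*a*f*f, 0 < a*f*f*f & 0 < f*f*f*f].
  by split; rewrite !mulr_gt0.
case: mono => M1 M2 M3 M4 M5.
have Kc : [/\ (a + b) * f = (2 * a + f) * f, (b + c) * f = (a + f) * f + a * (2 * a + f),
   (a + b + c) * f = (2 * a + f) * f + a * (2 * a + f) & b * f = (a + f) * f].
  by rewrite Ef; split; rewrite ?mulrDl ?Hc; ring.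
case: Kc => K1 K2 K3 K4.
move=> xy; split.
- move: xy; rewrite /gap_pairs !inE !xpair_eqE => /or4P [|||/or3P []] /andP [/eqP -> /eqP ->];
  by move: a_gt0 b_gt0 c_gt0 a_lt_c; lra.
- move=> /scale; move: xy; rewrite /gap_pairs !inE !xpair_eqE.
  move=> /or4P [|||/or3P []] /andP [/eqP -> /eqP ->]; rewrite ?K1 ?K2 ?K3 ?K4 ?Hc Ef; try by lra.
  move=> E; have [_ _] := irrational_cubics f a_gt0; apply.
  by apply: (@mulfI _ (2 * a)); [rewrite gt_eqF // mulr_gt0 | lra].
- move=> /scale; move: xy; rewrite /gap_pairs !inE !xpair_eqE.
  move=> /or4P [|||/or3P []] /andP [/eqP -> /eqP ->]; rewrite ?K1 ?K2 ?K3 ?K4 ?Hc Ef; by lra.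
- move=> /scale; move: xy; rewrite /gap_pairs !inE !xpair_eqE.
  move=> /or4P [|||/or3P []] /andP [/eqP -> /eqP ->]; rewrite ?K1 ?K2 ?K3 ?K4 ?Hc Ef; by lra.
Qed.

(** Equal coefficients must receive equal twists, and the only twists annihilating [1] and [k] with
    this property are multiples of [cf]; hence zero is taken. The isotropic form lemma replaces the
    twist, and accidents do not occur, so all weights are zero. *)
Lemma coincident_local_data :
  local_data (positions a b c) cf (fun=> 0) (fun=> 0%N).
Proof.
have ab_gt0 : 0 < a * b by rewrite mulr_gt0.
have f_gt0 : 0 < b - a by rewrite subr_gt0.
have P_gt0 : 0 < a ^+ 2 + b ^+ 2 by rewrite addr_gt0 // exprn_gt0.
have Q_gt0 : 0 < (a + b) ^+ 2 by rewrite exprn_gt0 // addr_gt0.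
have S_gt0 : 0 < (b - a) ^+ 2 by rewrite exprn_gt0.
have PQ : a ^+ 2 + b ^+ 2 < (a + b) ^+ 2 by lra.
have SP : (b - a) ^+ 2 < a ^+ 2 + b ^+ 2 by lra.
have abs_cf i : `|cf i| = nth 0 [:: a ^+ 2 + b ^+ 2; (a + b) ^+ 2; a ^+ 2 + b ^+ 2; (b - a) ^+ 2] i.
  by case: (ord4P i) => ->; rewrite /cf /= ?normrN gtr0_norm.
have cf0 i : cf i != 0.
  by rewrite -normr_gt0 abs_cf; case: (ord4P i) => ->.
have Hf : (b - a) * (a + b + c) = b * (a + b) by move: coincident; lra.
split.
- by split=> //; exact: positions_inj.
- move=> i j; rewrite !abs_cf => E; split=> //; move: E; rewrite /cf.
  by case: (ord4P i) => ->; case: (ord4P j) => -> //= E; exfalso; move: E PQ SP; lra.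
- rewrite !sum4 /cf /positions /=; split; try by ring.
    transitivity ((a + b) ^+ 2 * a - (a ^+ 2 + b ^+ 2) * (a + b) + (b - a) * ((b - a) * (a + b + c))).
      by ring.
    by rewrite Hf; ring.
  transitivity ((a + b) ^+ 2 * a ^+ 2 - (a ^+ 2 + b ^+ 2) * (a + b) ^+ 2 + ((b - a) * (a + b + c)) ^+ 2).
    by ring.
  by rewrite Hf; ring.
move=> sg t t1 [i0 ti0] E1 E2 _.
(* Characters 0 and 2 are merged before counting, since no relation can tell them apart. *)
pose cl (s : 'I_4) : 'I_4 := if s == o2 then o0 else s.
have cf_cl s : cf (cl s) = cf s by rewrite /cl; case: eqP => // ->.
pose x i := cl (sg i); pose e := class_sum x t.
have e2 : e o2 = 0.
  rewrite /e /class_sum big1 // => i _; case: eqP => //; rewrite /x /cl.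
  by case: eqP => // n H; case: n.
have e_bound : `|e o0| + `|e o1| + `|e o3| <= 4.
  have := class_sum_bound x t; rewrite !sum4 -/e e2 normr0.
  by move: (t1 o0) (t1 o1) (t1 o2) (t1 o3); lra.
have [|||m0 l0] := @small_isotropic_form a b (e o1 + e o3 - e o0) (e o1 - e o3) a_gt0 a_lt_b.
- by clear -e_bound; lia.
- by clear -e_bound; lia.
- rewrite -[RHS]E1 (eq_bigr (fun i => t i * cf (x i))) => [|i _]; last by rewrite cf_cl.
  by rewrite (class_sumE x t cf) sum4 -/e e2 /cf /=; ring.
have e3 : e o3 = e o1 by lra.
have e0 : e o0 = 2 * e o1 by lra.
have St : \sum_i t i = 4 * e o1.
  by rewrite -(class_sum_total x t) sum4 -/e e0 e2 e3; ring.
have [z1|z1] := eqVneq (e o1) 0.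
  exfalso.
  have H u : (if x o0 == u then t o0 else 0) + (if x o1 == u then t o1 else 0) +
      (if x o2 == u then t o2 else 0) + (if x o3 == u then t o3 else 0) = 0.
    rewrite -(sum4 (fun i => if x i == u then t i else 0)) -[LHS]/(e u).
    by case: (ord4P u) => ->; rewrite ?e0 ?e2 ?e3 ?z1 ?mulr0.
  have St0 : t o0 + t o1 + t o2 + t o3 = 0 by rewrite -sum4 St z1 mulr0.
  have ac : a != c by rewrite lt_eqF.
  have E2' : t o1 * cf (x o1) * a + t o2 * cf (x o2) * (a + b) +
     t o3 * cf (x o3) * (a + b + c) = 0.
    by rewrite -[RHS]E2 sum4 /positions /= !cf_cl; ring.
  have := vanishing_sign_pattern cf0 a_gt0 b_gt0 c_gt0 ac (t1 o0) (t1 o1) (t1 o2) (t1 o3) St0 H E2'.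
  case=> [[y0 y1 y2 y3]|[_ [u [v [uv [[y y'] gxy /= Exy] _]]]]].
    by move: ti0; case: (ord4P i0) => ->; rewrite ?y0 ?y1 ?y2 ?y3 eqxx.
  have gyx : (y', y) \in gap_pairs a b c.
    move: gxy; rewrite /gap_pairs !inE !xpair_eqE.
    by move=> /or4P [|||/or3P []] /andP [-> ->]; rewrite ?orbT.
  have [N1 N2 N3 N4] := coincident_gap_ratios gxy.
  have [M1 M2 M3 M4] := coincident_gap_ratios gyx.
  have P0 : a ^+ 2 + b ^+ 2 != 0 by rewrite gt_eqF.
  by move: Exy uv; rewrite !abs_cf; case: (ord4P u) => ->; case: (ord4P v) => -> //= Exy _;
    first [ exact: (N1 (mulfI P0 Exy)) | exact: (N2 Exy) | exact: (N3 Exy) | exact: (N4 Exy)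
          | exact: (M2 (esym Exy)) | exact: (M3 (esym Exy)) | exact: (M4 (esym Exy)) ].
(* The signs sum to [4 * e o1], with [e o1] nonzero; four signs of modulus at most one reach this
   only if all of them equal [e o1]. *)
have tE i : t i = e o1.
  move: St; rewrite sum4; move: (t1 o0) (t1 o1) (t1 o2) (t1 o3) z1 e_bound; rewrite e0 e3.
  by case: (ord4P i) => ->; clear; lia.
left; split; first by move=> i j; rewrite !tE.
have cnt s : e s = e o1 -> (\sum_(i < 4) (x i == s) = 1)%N.
  rewrite {1}/e /class_sum => Es.
  have : (e o1) * (\sum_(i < 4) (x i == s))%N%:R = e o1 * 1.
    rewrite mulr1 -[RHS]Es natr_sum mulr_sumr; apply: eq_bigr => i _.
    by rewrite tE; case: (x i == s); rewrite ?mulr1 ?mulr0.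
  by move=> /(mulfI z1) /eqP; rewrite pnatr_eq1 => /eqP.
have xs s : s != o0 -> s != o2 -> forall i, (x i == s) = (sg i == s).
  move=> s0 s2 i; rewrite /x /cl; have [->|//] := eqVneq (sg i) o2.
  by rewrite eq_sym (negbTE s0) eq_sym (negbTE s2).
split; last by rewrite !big1.
  by rewrite -[RHS](cnt o1) //; apply: eq_bigr => i _; rewrite xs.
by rewrite -[RHS](cnt o3) //; apply: eq_bigr => i _; rewrite xs.
Qed.

End CoincidentLocalData.

Lemma local_data_exists (a b c : int) : 0 < a -> 0 < b -> a < c ->
  exists cf lm wt, local_data (positions a b c) cf lm wt.
Proof.
move=> a_gt0 b_gt0 a_lt_c.
have [E|E] := eqVneq (b * c) (a * (a + b + c)).
  by eexists _, _, _; exact: coincident_local_data.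
have [wt D] := generic_local_data a_gt0 b_gt0 a_lt_c E.
by eexists _, _, _; exact: D.
Qed.

(** * Surviving patterns *)

Lemma intr_Zp_eq0 (N : nat) (z : int) : prime N -> `|z| < N%:Z ->
  (z%:~R : 'Z_N) = 0 -> z = 0.
Proof.
move=> N_prime zN.
have nat_case n : (n < N)%N -> (n%:R : 'Z_N) = 0 -> n = 0%N.
  move=> nN /(congr1 val) /=; rewrite val_Zp_nat ?prime_gt1 //.
  by rewrite modn_small.
case: z zN => n zN; first by move=> H; rewrite (nat_case n) //; move: zN; lia.
rewrite NegzE rmorphN /= => /eqP; rewrite oppr_eq0 => /eqP H.
by have := nat_case n.+1; move: zN; rewrite NegzE => zN /(_ _ H); lia.
Qed.

Lemma sum_pair (I : finType) (b : pred I) (F : I -> int) (i j : I) : i != j ->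
  b i -> b j -> (forall l, b l -> l = i \/ l = j) ->
  \sum_l (if b l then F l else 0) = F i + F j.
Proof.
move=> ij bi bj H; rewrite (bigD1 i) //= bi (bigD1 j) /= 1?eq_sym // bj big1 ?addr0 //.
move=> l /andP [li lj]; case: ifP => // /H [] E; first by rewrite E eqxx in li.
by rewrite E eqxx in lj.
Qed.

(** * Atoms and the digits of their frequency sums *)

Section Atoms.
Variables (m G : nat) (D : int).

(** A scale, a character and a sign vector. In [option atom], [None] stands for the constant term
    [1]; the zero sign vector stays in the type, so that sums over vectors factor, and is excluded
    by [active]. *)
Definition atom := ('I_G * ('I_4 * signvec m))%type.

Definition atom_vec (x : option atom) (r : 'I_m) : int :=
  if x is Some (_, (_, v)) then sign_val (v r) else 0.
Definition atom_char (x : option atom) : 'I_4 :=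
  if x is Some (_, (s, _)) then s else o0.
Definition atom_group (x : option atom) : option 'I_G :=
  if x is Some (g, _) then Some g else None.
Definition opp_atom (x : option atom) : option atom :=
  if x is Some (g, (s, v)) then Some (g, (s, oppvec v)) else None.
Definition active (x : option atom) : bool :=
  if x is Some (_, (_, v)) then v != zerovec m else true.

(* A frequency of group [g]: the base-[D] encoding of the sign vector, scaled
   by the group's multiplier [beta g] and by the coefficient of the character. *)
Definition frequency (beta : 'I_G -> int) (f : 'I_4 -> int) (x : option atom) : int :=
  if x is Some (g, (s, v)) then beta g * encode D v * f s else 0.

Lemma opp_atomK : involutive opp_atom.
Proof. by case=> [[g [s v]]|] //=; rewrite oppvecK. Qed.

Lemma frequency_opp beta f x : frequency beta f (opp_atom x) = - frequency beta f x.
Proof. by case: x => [[g [s v]]|] /=; rewrite ?oppr0 // encode_opp mulrN mulNr. Qed.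

Lemma atom_vec_norm x r : `|atom_vec x r| <= 1.
Proof. by case: x => [[g [s v]]|] //=; rewrite ?sign_val_norm ?normr0. Qed.

Lemma active_vec x g : active x -> atom_group x = Some g -> exists r, atom_vec x r != 0.
Proof. by case: x => [[g' [s v]]|] //= nz _; exact: signvec_neq0. Qed.

Section Patterns.
Variables (n : nat) (X : 'I_n -> option atom).

Definition digit (F : 'I_n -> 'I_4 -> int) (g : 'I_G) (r : 'I_m) : int :=
  \sum_i (if atom_group (X i) == Some g then atom_vec (X i) r * F i (atom_char (X i)) else 0).

Lemma frequency_sum beta F :
  \sum_i frequency beta (F i) (X i) = \sum_g beta g * \sum_(r < m) D ^+ r * digit F g r.
Proof.
have E x f : frequency beta f x = \sum_g beta g * \sum_(r < m) D ^+ r *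
    (if atom_group x == Some g then atom_vec x r * f (atom_char x) else 0).
  case: x => [[g [s v]]|] /=; last first.
    by rewrite big1 // => g _; rewrite big1 ?mulr0 // => r _; rewrite mulr0.
  rewrite (bigD1 g) //= eqxx [X in _ + X]big1 ?addr0.
    rewrite -mulrA; congr (_ * _); rewrite /encode mulr_suml.
    by apply: eq_bigr => r _; rewrite mulrA.
  move=> h /negbTE hg; rewrite big1 ?mulr0 // => r _.
  by rewrite (inj_eq Some_inj) eq_sym hg mulr0.
under eq_bigr => i _ do rewrite E.
rewrite exchange_big /=; apply: eq_bigr => g _; rewrite -mulr_sumr; congr (_ * _).
rewrite exchange_big /=; apply: eq_bigr => r _; rewrite -mulr_sumr.
by [].
Qed.

(** Patterns have four slots in the correlation and eight in the moment, whence the factor 8 in the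
    conditions on [D]. *)
Lemma digit_bound F : 0 < D -> (n <= 8)%N -> (forall i s, 8 * `|F i s| < D) ->
  forall g r, `|digit F g r| < D.
Proof.
move=> D_gt0 n8 FD g r; rewrite -(@ltr_pM2l _ 8) // /digit.
apply: (@le_lt_trans _ _ (\sum_(i < n) (D - 1))).
  apply: (@le_trans _ _ (\sum_(i < n) 8 * `|if atom_group (X i) == Some g
      then atom_vec (X i) r * F i (atom_char (X i)) else 0|)).
    by rewrite -mulr_sumr ler_pM2l // ler_norm_sum.
  apply: ler_sum => i _; case: ifP => _; last by rewrite normr0 mulr0 -ltzD1 subrK.
  rewrite -ltzD1 subrK; apply: le_lt_trans (FD i (atom_char (X i))).
  by rewrite ler_pM2l // normrM ler_piMl // atom_vec_norm.
rewrite sumr_const card_ord -mulr_natl.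
have n8' : (n%:R : int) <= 8 by rewrite (ler_nat _ n 8).
have D1 : 0 <= D - 1 by rewrite -ltzD1 subrK.
by clear -n8' D1; nra.
Qed.

(** Digit uniqueness is used twice: base [B] separates the scales, then base [D] separates the
    coordinates inside one scale. *)
Lemma digit_eq0 (B : int) F : 0 < D -> (n <= 8)%N -> D ^+ m <= B ->
  (forall i s, 8 * `|F i s| < D) ->
  \sum_i frequency (fun g => B ^+ g) (F i) (X i) = 0 -> forall g r, digit F g r = 0.
Proof.
move=> D_gt0 n8 DB FD; rewrite frequency_sum => E g r.
have dF := digit_bound D_gt0 n8 FD.
have B_gt0 : 0 < B by apply: lt_le_trans DB; rewrite exprn_gt0.
have := digits_eq0 B_gt0 _ E.
move=> /(_ (fun g => lt_le_trans (digits_bound D_gt0 (dF g)) DB) g).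
by move=> Eg; exact: (digits_eq0 D_gt0 (dF g) Eg r).
Qed.

End Patterns.
End Atoms.

(** * Relations among the atoms of a pattern *)

Section Survivors.
Variables (m G : nat) (D : int) (k c lam : 'I_4 -> int) (wt : 'I_4 -> nat).
Hypothesis LD : local_data k c lam wt.
Hypothesis D_gt0 : 0 < D.
Hypothesis D_c : forall s, 8 * `|c s| < D.
Hypothesis D_ck : forall s i, 8 * `|c s * k i| < D.
Hypothesis D_lam : forall s, 8 * `|lam s| < D.

Local Notation atom := (atom m G).
(** Twice the length of a digit block, so that a product of two block values still lies below
    [B]. *)
Definition big_base : int := D ^+ m * D ^+ m.
Local Notation B := big_base.

Definition quad_freq (x : option atom) := frequency D (fun g => B ^+ g) c x.
(** The exponent [2 * g] against [g] makes the ratio of linear to quadratic frequency grow like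
    [B^g], which identifies the scale. *)
Definition lin_freq (x : option atom) := frequency D (fun g => B ^+ (2 * g)) lam x.

Lemma D_pow_le_big_base : D ^+ m <= B.
Proof. by rewrite ler_peMr ?exprn_ege1 ?exprn_ge0 ?(ltW D_gt0) // -gtz0_ge1. Qed.

Lemma digit_singleton n (X : 'I_n -> option atom) i g :
  active (X i) -> atom_group (X i) = Some g ->
  (forall r, digit X (fun _ => c) g r = 0) -> exists2 j, j != i & atom_group (X j) = Some g.
Proof.
move=> Xi gi H; case: (boolP [exists j, (j != i) && (atom_group (X j) == Some g)]).
  by case/existsP => j /andP [ji /eqP gj]; exists j.
rewrite negb_exists => /forallP nj; exfalso.
have [r vr] := active_vec Xi gi.
have := H r; rewrite /digit (bigD1 i) //= gi eqxx big1 ?addr0.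
  case: LD => [[_ c0 _] _ _ _] /eqP; rewrite mulf_eq0 (negbTE vr).
  by rewrite (negbTE (c0 _)).
by move=> j ji; have := nj j; rewrite ji /= => /negbTE ->.
Qed.

Section Pattern.
Variable X : 'I_4 -> option atom.
Hypothesis X_active : forall i, active (X i).

Local Notation P := (\sum_i quad_freq (X i) * k i).
Local Notation digit_c := (digit X (fun _ => c)).
Local Notation digit_ck := (digit X (fun i s => c s * k i)).
Local Notation digit_lam := (digit X (fun _ => lam)).

Lemma quad_moment_eq : P = \sum_i frequency D (fun g => B ^+ g) (fun s => c s * k i) (X i).
Proof.
apply: eq_bigr => i _; rewrite /quad_freq; case: (X i) => [[g [s v]]|] /=; last by rewrite mul0r.
by rewrite mulrA.
Qed.

Lemma pair_cancel (y y' : 'I_m -> int) s s' :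
  (forall r, `|y r| <= 1) -> (forall r, `|y' r| <= 1) -> (exists r, y r != 0) ->
  (forall r, y r * c s + y' r * c s' = 0) ->
  [/\ c s = c s', lam s = lam s' & forall r, y' r = - y r].
Proof.
case: LD => [[_ c0 _] cabs _ _] y1 y'1 [r0 yr0] E.
have norm1 (z : int) : `|z| <= 1 -> z != 0 -> `|z| = 1 by clear; lia.
have E0 : y' r0 * c s' = - (y r0 * c s) by have := E r0; lra.
have y'0 : y' r0 != 0.
  apply: contraTneq isT => y0; move/eqP: E0; rewrite y0 mul0r eq_sym oppr_eq0 mulf_eq0.
  by rewrite (negbTE yr0) (negbTE (c0 s)).
have [cE lE] : c s = c s' /\ lam s = lam s'.
  apply: cabs; move/(congr1 Num.norm): E0; rewrite normrN !normrM.
  by rewrite (norm1 (y r0)) // (norm1 (y' r0)) // !mul1r => ->.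
split=> // r; apply: (@mulIf _ (c s)) => //.
by have := E r; rewrite -cE; lra.
Qed.

(** Two atoms alone in their scale have opposite sign vectors and the same coefficient, hence the
    same twist. The linear parts cancel, but the moment does not, because the positions differ. *)
Lemma digit_pair i j g : i != j -> atom_group (X i) = Some g -> atom_group (X j) = Some g ->
  (forall l, atom_group (X l) = Some g -> l = i \/ l = j) ->
  (forall r, digit_c g r = 0) ->
  (forall r, digit_lam g r = 0) /\ exists r, digit_ck g r != 0.
Proof.
move=> ij gi gj H Hc.
have pairE F r : digit X F g r = atom_vec (X i) r * F i (atom_char (X i)) +
     atom_vec (X j) r * F j (atom_char (X j)).
  rewrite /digit; apply: (sum_pair (b := fun l => atom_group (X l) == Some g)) => //.
  - exact/eqP.
  - exact/eqP.
  - by move=> l /eqP /H.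
have ex := active_vec (X_active i) gi.
have [|cE lE vE] := @pair_cancel (atom_vec (X i)) (atom_vec (X j)) (atom_char (X i))
   (atom_char (X j)) (atom_vec_norm _) (atom_vec_norm _) ex.
  by move=> r; rewrite -(pairE (fun _ => c)).
split; first by move=> r; rewrite pairE vE lE mulNr subrr.
case: ex => r vr; exists r; rewrite pairE vE cE mulNr -mulrBr -mulrBr.
case: LD => [[k_inj c0 _] _ _ _]; rewrite !mulf_neq0 // subr_eq0.
by rewrite (inj_eq k_inj).
Qed.

Lemma lin_freq_sum : \sum_i lin_freq (X i) =
  \sum_(g < G) B ^+ (2 * g) * \sum_(r < m) D ^+ r * digit_lam g r.
Proof. exact: frequency_sum. Qed.

Hypothesis quad0 : \sum_i quad_freq (X i) = 0.

Lemma digit_c_eq0 g r : digit_c g r = 0.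
Proof.
by apply: digit_eq0 D_pow_le_big_base _ quad0 _ _ => // _ s; exact: D_c.
Qed.

Lemma digit_ck_eq0 : P = 0 -> forall g r, digit_ck g r = 0.
Proof.
rewrite quad_moment_eq => P0; exact: digit_eq0 D_pow_le_big_base _ P0.
Qed.

(** No scale occurs just once, so two scales would fill the four slots in pairs. All linear parts
    then cancel, the hypothesis gives [P = 0], and the nonzero moment digit of a pair contradicts
    it. *)
Lemma single_group : (\sum_i lin_freq (X i) = 0 -> P = 0) ->
  forall i j g h, atom_group (X i) = Some g -> atom_group (X j) = Some h -> g = h.
Proof.
move=> HP i j g h gi hj; apply/eqP; apply: contraT => gh.
have [i' ii' gi'] := digit_singleton (X_active _) gi (digit_c_eq0 g).
have [j' jj' hj'] := digit_singleton (X_active _) hj (digit_c_eq0 h).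
have nij a b : atom_group (X a) = Some g -> atom_group (X b) = Some h -> a != b.
  move=> ga hb; apply: contraNneq gh => ab; move: ga; rewrite ab hb => -[->].
  by [].
have cover l : l \in [:: i; i'; j; j'].
  have U : uniq [:: i; i'; j; j'].
    rewrite /= !inE !negb_or (eq_sym i i') ii' (eq_sym j j') jj'.
    by rewrite (nij i j) // (nij i j') // (nij i' j) // (nij i' j').
  have /subset_cardP /(_ (subset_predT _)) -> : #|[:: i; i'; j; j']| = #|'I_4|.
    by rewrite (card_uniqP U) card_ord.
  by [].
have Hg l : atom_group (X l) = Some g -> l = i \/ l = i'.
  move=> gl; have := cover l; rewrite !inE.
  by case/or4P => /eqP E; [left|right| |] => //; have := nij l _ gl hj; have := nij l _ gl hj';
    rewrite E eqxx.
have Hh l : atom_group (X l) = Some h -> l = j \/ l = j'.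
  move=> hl; have := cover l; rewrite !inE.
  by case/or4P => /eqP E; [| |left|right] => //; have := nij _ l gi hl; have := nij _ l gi' hl;
    rewrite E eqxx.
rewrite eq_sym in ii'; rewrite eq_sym in jj'.
have [Lg [r ckr]] := digit_pair ii' gi gi' Hg (digit_c_eq0 g).
have [Lh _] := digit_pair jj' hj hj' Hh (digit_c_eq0 h).
have L0 : \sum_i lin_freq (X i) = 0.
  rewrite lin_freq_sum big1 // => a _; rewrite big1 ?mulr0 // => q _.
  have [->|ag] := eqVneq a g; first by rewrite Lg mulr0.
  have [->|ah] := eqVneq a h; first by rewrite Lh mulr0.
  rewrite /digit big1 ?mulr0 // => l _; case: eqP => // la.
  have := cover l; rewrite !inE => /or4P [] /eqP E; move: la; rewrite E ?gi ?gi' ?hj ?hj' => -[E'];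
    by rewrite ?E' ?eqxx in ag ah.
by move: ckr; rewrite digit_ck_eq0 ?eqxx // HP.
Qed.

(** An occupied scale has at least two slots, and with exactly two its linear parts cancel. Three
    atoms are what yields the factor [mu^3]. *)
Lemma support_ge3 : \sum_i lin_freq (X i) != 0 ->
  (forall i j g h, atom_group (X i) = Some g -> atom_group (X j) = Some h -> g = h) ->
  (3 <= #|[set i | X i != None]|)%N.
Proof.
move=> L0 sg; rewrite ltnNge; apply: contra L0 => small; apply/eqP.
have groupE i : X i != None -> exists g, atom_group (X i) = Some g.
  by case: (X i) => [[g sv]|] // _; exists g.
rewrite lin_freq_sum big1 // => g _; rewrite big1 ?mulr0 // => r _.
suff -> : digit_lam g r = 0 by rewrite mulr0.
case: (boolP [exists i, atom_group (X i) == Some g]) => [/existsP [i /eqP gi]|]; last first.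
  rewrite negb_exists => /forallP H; rewrite /digit big1 // => i _.
  by rewrite (negbTE (H i)).
have [j ji gj] := digit_singleton (X_active _) gi (digit_c_eq0 g).
rewrite eq_sym in ji.
have [] // := digit_pair ji gi gj _ (digit_c_eq0 g).
move=> l gl; have [|li] := eqVneq l i; first by left.
have [|lj] := eqVneq l j; [by right | exfalso].
have : [set i; j; l] \subset [set i | X i != None].
  apply/subsetP => x; rewrite !inE -orbA => /or3P [] /eqP ->.
  - by case: (X i) gi.
  - by case: (X j) gj.
  - by case: (X l) gl.
move/subset_leq_card/leq_trans => /(_ _ small).
by rewrite -setUA cardsU1 cards2 !inE negb_or ji eq_sym li /= eq_sym lj.
Qed.

Section OneGroup.
Variable g : 'I_G.
Hypothesis X_group : forall i, X i != None -> atom_group (X i) = Some g.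

Lemma digit_one_group F r :
  digit X F g r = \sum_i atom_vec (X i) r * F i (atom_char (X i)).
Proof.
apply: eq_bigr => i _; have := @X_group i; case: (X i) => [[h sv]|] //=; last by rewrite mul0r.
by move=> /(_ isT) ->; rewrite eqxx.
Qed.

Lemma digit_other_group F h r : h != g -> digit X F h r = 0.
Proof.
move=> hg; rewrite /digit big1 // => i _; have := @X_group i; case: (X i) => [[h' sv]|] //=.
by move=> /(_ isT) [->]; case: eqP => // -[E]; rewrite E eqxx in hg.
Qed.

Lemma frequency_one_group beta F :
  \sum_i frequency D beta (F i) (X i) = beta g * \sum_(r < m) D ^+ r * digit X F g r.
Proof.
rewrite frequency_sum (bigD1 g) //= [X in _ + X]big1 ?addr0 // => h hg.
by rewrite big1 ?mulr0 // => r _; rewrite digit_other_group // mulr0.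
Qed.

(** These relations hold for every [d]. The classification in [local_data] is applied to each
    coordinate of the sign vectors. *)
Lemma permanent_pattern : (exists i, X i != None) -> P = 0 ->
  \sum_i lin_freq (X i) = 0 ->
  (exists (sg : 'I_4 -> 'I_4) (v : signvec m),
    [/\ v != zerovec m, forall i, X i = Some (g, (sg i, v)), good_assignment wt sg
      & [/\ \sum_i c (sg i) = 0, \sum_i c (sg i) * k i = 0 & \sum_i lam (sg i) = 0]])
  \/ ((forall i, X i != None) /\
      (\sum_(i < 4) wt i < \sum_(i < 4) wt (atom_char (X i)))%N).
Proof.
case=> i0 Xi0 P0 L0.
have ckE := digit_ck_eq0 P0.
have lamE r : digit_lam g r = 0.
  have bd q : `|digit_lam g q| < D by apply: digit_bound.
  apply: (digits_eq0 D_gt0 bd); apply/eqP; move/eqP: L0.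
  rewrite /lin_freq (frequency_one_group (fun g => B ^+ (2 * g)) (fun _ => lam)) mulf_eq0.
  by rewrite expf_eq0 !mulf_eq0 !expf_eq0 gt_eqF // !andbF.
pose sg i := atom_char (X i).
have scal r : (exists i, atom_vec (X i) r != 0) ->
  ((forall i j, atom_vec (X i) r = atom_vec (X j) r) /\ good_assignment wt sg) \/
  ((forall i, atom_vec (X i) r != 0) /\ (\sum_(i < 4) wt i < \sum_(i < 4) wt (sg i))%N).
  case: LD => _ _ _ main ex; apply: main => //.
  - by move=> i; exact: atom_vec_norm.
  - by rewrite -[RHS](digit_c_eq0 g r) digit_one_group.
  - rewrite -[RHS](ckE g r) digit_one_group; apply: eq_bigr => i _.
    by rewrite mulrA.
  - by rewrite -[RHS](lamE r) digit_one_group.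
have Xnone i r : atom_vec (X i) r != 0 -> X i != None.
  by case: (X i) => //=; rewrite eqxx.
have [r vr] := active_vec (X_active i0) (X_group Xi0).
have [[tE gs]|[tn wlt]] := scal r (ex_intro _ i0 vr); last first.
  by right; split=> // i; exact: Xnone (tn i).
left; exists sg.
have tr0 i : atom_vec (X i) r != 0 by rewrite (tE i i0).
have Xg i : X i != None by exact: Xnone (tr0 i).
(* The assignment [sg] is common to all coordinates. It preserves the weight at coordinate [r], so
   no coordinate can fall in the alternative of strictly larger weight. *)
have const q i : atom_vec (X i) q = atom_vec (X o0) q.
  case: (boolP [exists i, atom_vec (X i) q != 0]) => [/existsP /scal [[E _]|[_]]|]; first exact: E.
    by case: gs => _ _ ->; rewrite ltnn.
  by rewrite negb_exists => /forallP Z; rewrite (eqP (negPn (Z i))) (eqP (negPn (Z o0))).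
have := Xg o0; case E0 : (X o0) => [[h [s v]]|] // _.
have hE : h = g by have := X_group (Xg o0); rewrite E0 => -[].
exists v; split=> //.
- by have := X_active o0; rewrite E0.
- move=> i; have := Xg i; have := X_group (Xg i); rewrite /sg.
  case Ei : (X i) => [[h' [s' v']]|] //= -[->] _; congr (Some (_, (_, _))).
  apply/ffunP => q; apply: sign_val_inj; have := const q i.
  by rewrite Ei E0.
- have fac (F : 'I_4 -> 'I_4 -> int) : digit X F g r = 0 -> \sum_i F i (sg i) = 0.
    rewrite digit_one_group (eq_bigr (fun i => atom_vec (X o0) r * F i (sg i))).
      rewrite -mulr_sumr => /eqP; rewrite mulf_eq0 (negbTE (tr0 o0)).
      by move/eqP.
    by move=> i _; rewrite (const r i).
  split; first exact: (fac (fun _ => c) (digit_c_eq0 g r)).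
    exact: (fac (fun i s => c s * k i) (ckE g r)).
  exact: (fac (fun _ => lam) (lamE r)).
Qed.

End OneGroup.
End Pattern.

(** After the powers of [B] are factored out, distinct scales would make [B] divide a nonzero
    product of two integers below [D^m], which is smaller than [B]. *)
Lemma exceptional_group_unique (X X' : 'I_4 -> option atom) (g g' : 'I_G) :
  (forall i, X i != None -> atom_group (X i) = Some g) ->
  (forall i, X' i != None -> atom_group (X' i) = Some g') ->
  \sum_i quad_freq (X i) * k i != 0 -> \sum_i quad_freq (X' i) * k i != 0 ->
  \sum_i lin_freq (X i) != 0 -> \sum_i lin_freq (X' i) != 0 ->
  (\sum_i quad_freq (X i) * k i) * (\sum_i lin_freq (X' i)) =
  (\sum_i quad_freq (X' i) * k i) * (\sum_i lin_freq (X i)) -> g = g'.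
Proof.
have bd (Y : 'I_4 -> option atom) h F : (forall i s, 8 * `|F i s| < D) ->
    `|\sum_(r < m) D ^+ r * digit Y F h r| < D ^+ m.
  by move=> FD; apply: digits_bound => // r; apply: digit_bound.
have B_gt0 : 0 < B by rewrite mulr_gt0 // exprn_gt0.
have B0 : B != 0 by rewrite gt_eqF.
have key (e : nat) (u v u' v' : int) : (0 < e)%N -> `|u| < D ^+ m -> `|v| < D ^+ m ->
    u != 0 -> v != 0 -> u * v = B ^+ e * (u' * v') -> False.
  case: e => // e _ hu hv u0 v0; rewrite exprS -mulrA => E.
  have : (B %| u * v)%Z by apply/dvdzP; exists (B ^+ e * (u' * v')); rewrite E mulrC.
  move=> /dvdn_leq; rewrite absz_gt0 mulf_neq0 // => /(_ isT).
  have : `|u * v| < B by rewrite normrM ltr_pM.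
  by rewrite /big_base; clear -B_gt0; move: B_gt0; rewrite /big_base; lia.
move=> Xg Xg'; rewrite !quad_moment_eq.
rewrite (frequency_one_group Xg (fun h => B ^+ h)) (frequency_one_group Xg' (fun h => B ^+ h)).
rewrite /lin_freq (frequency_one_group Xg (fun h => B ^+ (2 * h)) (fun _ => lam)).
rewrite (frequency_one_group Xg' (fun h => B ^+ (2 * h)) (fun _ => lam)).
set u := \sum_(r < m) _; set u' := \sum_(r < m) _; set v := \sum_(r < m) _; set v' := \sum_(r < m) _.
rewrite !mulf_eq0 !negb_or => /andP [_ u0] /andP [_ u0'] /andP [_ v0] /andP [_ v0'] E.
have [hu hu'] : `|u| < D ^+ m /\ `|u'| < D ^+ m by split; apply: bd.
have [hv hv'] : `|v| < D ^+ m /\ `|v'| < D ^+ m by split; apply: bd.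
apply: val_inj => /=; case: (ltngtP g g') => // gg'; exfalso.
- apply: (@key (g' - g)%N u' v u v'); rewrite ?subn_gt0 //.
  apply: (@mulfI _ (B ^+ (2 * g + g'))); first by rewrite expf_neq0.
  transitivity (B ^+ g' * u' * (B ^+ (2 * g) * v)); first by rewrite exprD; ring.
  rewrite -E [RHS]mulrA -exprD.
  have -> : (2 * g + g' + (g' - g) = g + 2 * g')%N by clear -gg'; lia.
  by rewrite exprD; ring.
- apply: (@key (g - g')%N u v' u' v); rewrite ?subn_gt0 //.
  apply: (@mulfI _ (B ^+ (2 * g' + g))); first by rewrite expf_neq0.
  transitivity (B ^+ g * u * (B ^+ (2 * g') * v')); first by rewrite exprD; ring.
  rewrite E [RHS]mulrA -exprD.
  have -> : (2 * g' + g + (g - g') = g' + 2 * g)%N by clear -gg'; lia.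
  by rewrite exprD; ring.
Qed.

End Survivors.

(** Eight slots with no scale used once involve at most four scales. Such a pattern is recovered
    from a labelling of the slots by four labels, of the labels by scales, and of the slots by [T];
    the gain is [G^4] in place of [G^8]. *)
Lemma card_no_singletons (G : nat) (T : finType) (S : {set {ffun 'I_8 -> option ('I_G * T)}}) :
  (forall X, X \in S -> forall i, exists g j, [/\ j != i, omap fst (X i) = Some g
     & omap fst (X j) = Some g]) ->
  (#|S| <= 4 ^ 8 * (G ^ 4 * #|T| ^ 8))%N.
Proof.
move=> H.
pose Phi (a : {ffun 'I_8 -> 'I_4} * ({ffun 'I_4 -> 'I_G} * {ffun 'I_8 -> T})) :
    {ffun 'I_8 -> option ('I_G * T)} := [ffun i => Some (a.2.1 (a.1 i), a.2.2 i)].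
have -> : (4 ^ 8 * (G ^ 4 * #|T| ^ 8) =
    #|{: {ffun 'I_8 -> 'I_4} * ({ffun 'I_4 -> 'I_G} * {ffun 'I_8 -> T})}|)%N.
  by rewrite !card_prod !card_ffun !card_ord.
suff /subset_leq_card sub : S \subset Phi @: setT.
  by apply: leq_trans sub _; apply: leq_trans (leq_imset_card _ _) _; rewrite cardsT.
apply/subsetP => X /H {}H.
have some i : exists gt, X i = Some gt.
  by have [g [j [_ + _]]] := H i; case: (X i) => // gt; exists gt.
have [[g0 t0] _] := some ord0.
pose gam i := if X i is Some (g, _) then g else g0.
pose tau i := if X i is Some (_, t) then t else t0.
have XE i : X i = Some (gam i, tau i).
  by rewrite /gam /tau; have [[g t] ->] := some i.
pose A := [set gam i | i : 'I_8].
have A4 : (#|A| <= 4)%N.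
  rewrite -(leq_pmul2r (_ : 0 < 2)%N) //.
  have -> : (4 * 2 = \sum_(i < 8) \sum_(g in A) (gam i == g))%N.
    rewrite (eq_bigr (fun=> 1%N)); first by rewrite sum1_card card_ord.
    move=> i _; rewrite (bigD1 (gam i)) ?imset_f //= eqxx big1 // => g /andP [_ /negbTE].
    by rewrite eq_sym => ->.
  rewrite exchange_big /= -sum_nat_const; apply: leq_sum => g /imsetP [i _ ->].
  have [g' [j [ji gi gj]]] := H i.
  have Eg : gam j = gam i by move: gi gj; rewrite !XE /= => -[->] [->].
  by rewrite (bigD1 i) //= eqxx (bigD1 j) //= Eg eqxx.
apply/imsetP; exists ([ffun i => inord (index (gam i) (enum A))],
   ([ffun j : 'I_4 => nth g0 (enum A) j], [ffun i => tau i])) => //.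
apply/ffunP => i; rewrite !ffunE /= XE; congr (Some (_, _)).
rewrite inordK.
  by rewrite nth_index // mem_enum imset_f.
by apply: leq_trans A4; rewrite cardE index_mem mem_enum imset_f.
Qed.

(** * The correlation at a fixed nonzero difference *)

Section CorrelationBound.
Variables (R : realType) (N : nat).
Hypothesis N_prime : prime N.
Variable w : complex R.
Hypothesis w_prim : N.-primitive_root w.
Variables (m G : nat) (D : int) (k c lam : 'I_4 -> int) (wt : 'I_4 -> nat).
Hypothesis LD : local_data k c lam wt.
Hypothesis D_gt0 : 0 < D.
Hypothesis D_c : forall s, 8 * `|c s| < D.
Hypothesis D_ck : forall s i, 8 * `|c s * k i| < D.
Hypothesis D_lam : forall s, 8 * `|lam s| < D.
Variables mu eps : R.
Hypothesis mu01 : 0 <= mu <= 1.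
Hypothesis eps01 : 0 <= eps <= 1.

Local Notation atom := (atom m G).
Local Notation pattern := {ffun 'I_4 -> option atom}.
Local Notation quad := (@quad_freq m G D c).
Local Notation lin := (@lin_freq m G D lam).
Local Notation B := (big_base m D).

(** Sign and Riesz weight sit on one character each, so a good assignment with sign vector [v] has
    product exactly [- mu^4 eps^weight * vec_weight v]. *)
Definition coef (x : option atom) : R :=
  if x is Some (_, (s, v)) then
    if v == zerovec m then 0 else
    mu * (if s == o1 then -1 else 1) * eps ^+ wt s * (if s == o3 then vec_weight R v else 1)
  else 1.

Lemma coef_opp x : coef (opp_atom x) = coef x.
Proof.
by case: x => [[g [s v]]|] //=; rewrite oppvec_eq0 vec_weight_opp.
Qed.

Lemma coef_active x : coef x != 0 -> active x.
Proof. by case: x => [[g [s v]]|] //=; case: (v == _); rewrite ?eqxx. Qed.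

Let mu_ge0 : 0 <= mu. Proof. by case/andP: mu01. Qed.
Let mu_le1 : mu <= 1. Proof. by case/andP: mu01. Qed.
Let eps_ge0 : 0 <= eps. Proof. by case/andP: eps01. Qed.
Let eps_le1 : eps <= 1. Proof. by case/andP: eps01. Qed.

Lemma norm_coef_some g s v : `|coef (Some (g, (s, v)))| <= mu * eps ^+ wt s.
Proof.
rewrite /coef; case: ifP => _; first by rewrite normr0 mulr_ge0 ?exprn_ge0.
rewrite !normrM (ger0_norm mu_ge0) (ger0_norm (exprn_ge0 _ eps_ge0)).
have -> : `|(if s == o1 then -1 else 1 : R)| = 1 by case: ifP; rewrite ?normrN normr1.
rewrite mulr1 ler_piMr ?mulr_ge0 ?exprn_ge0 //.
by case: ifP => _; rewrite ?normr1 // ger0_norm ?vec_weight_ge0 ?vec_weight_le1.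
Qed.

Lemma norm_coef_le_mu x : `|coef x| <= (if x != None then mu else 1).
Proof.
case: x => [[g [s v]]|] /=; last by rewrite normr1.
by apply: le_trans (norm_coef_some g s v) _; rewrite ler_piMr // exprn_ile1.
Qed.

Section FixedDifference.
Variables (d : 'Z_N) (delta : R).
Hypothesis d_neq0 : d != 0.
Hypothesis N_gt2 : (2 < N)%N.
Hypothesis delta_ge0 : 0 <= delta.
Hypothesis delta_N : (N%:R)^-1 <= delta ^+ 2.

Definition quad_sum (X : pattern) : int := \sum_i quad (X i).
Definition moment_sum (X : pattern) : int := \sum_i quad (X i) * k i.
Definition lin_sum (X : pattern) : int := \sum_i lin (X i).

Hypothesis quad_small : forall X, `|quad_sum X| < N%:Z.
Hypothesis moment_small : forall X, `|moment_sum X| < N%:Z.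
Hypothesis lin_small : forall X, `|lin_sum X| < N%:Z.
Hypothesis cross_small : forall X X',
  `|moment_sum X * lin_sum X' - moment_sum X' * lin_sum X| < N%:Z.

Definition pattern_coef (X : pattern) : R := \prod_i coef (X i).
Definition pattern_term (X : pattern) : R :=
  pattern_coef X *
    gauss w (quad_sum X)%:~R (2 * d * (moment_sum X)%:~R + (lin_sum X)%:~R)
      (d ^+ 2 * (\sum_(i < 4) quad (X i) * k i ^+ 2)%:~R
       + d * (\sum_(i < 4) lin (X i) * k i)%:~R).

Let two_neq0 : (2 : 'Z_N) != 0.
Proof.
apply/eqP => E; have := @intr_Zp_eq0 N 2 N_prime _ E.
by rewrite normr_nat; move: N_gt2; rewrite -ltz_nat => -> /(_ isT).
Qed.

Lemma correlation_pattern_sum :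
  expectation (fun t : 'Z_N => \prod_(i < 4) trig_poly w coef quad lin (t + (k i)%:~R * d))
  = \sum_(X : pattern) pattern_term X.
Proof.
exact: (correlation_expansion N_prime w_prim (@opp_atomK m G) coef_opp
  (frequency_opp _ _ _) (frequency_opp _ _ _)).
Qed.

Definition trivial_pattern : pattern := [ffun=> None].

Lemma trivial_pattern_term : pattern_term trivial_pattern = 1.
Proof.
rewrite /pattern_term /pattern_coef big1 => [|i _]; last by rewrite ffunE.
have z (F : option atom -> 'I_4 -> int) : (forall i, F None i = 0) ->
    \sum_i F (trivial_pattern i) i = 0.
  by move=> F0; rewrite big1 // => i _; rewrite ffunE.
rewrite /quad_sum /moment_sum /lin_sum (z (fun x _ => quad x)) // (z (fun x _ => lin x)) //.
rewrite (z (fun x i => quad x * k i)) => [|i]; last by rewrite mul0r.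
rewrite (z (fun x i => quad x * k i ^+ 2)) => [|i]; last by rewrite mul0r.
rewrite (z (fun x i => lin x * k i)) => [|i]; last by rewrite mul0r.
by rewrite !mulr0 !addr0 gauss_const // chi0 mulr1.
Qed.

Definition aligned (a : 'I_G * ({ffun 'I_4 -> 'I_4} * signvec m)) : pattern :=
  [ffun i => Some (a.1, (a.2.1 i, a.2.2))].

(** The conditions remove [t^2] and [t] from the phase but may leave a constant phase in [d]; for
    the identity assignment this phase vanishes as well. *)
Definition admissible (sg : {ffun 'I_4 -> 'I_4}) : bool :=
  [&& (\sum_(i < 4) (sg i == o1) == 1)%N, (\sum_(i < 4) (sg i == o3) == 1)%N,
      (\sum_(i < 4) wt (sg i) == \sum_(i < 4) wt i)%N,
      \sum_i c (sg i) == 0, \sum_i c (sg i) * k i == 0 & \sum_i lam (sg i) == 0].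

Definition aligned_index : {set 'I_G * ({ffun 'I_4 -> 'I_4} * signvec m)} :=
  [set a | admissible a.2.1 && (a.2.2 != zerovec m)].

Lemma aligned_inj : injective aligned.
Proof.
move=> [g [sg v]] [g' [sg' v']] /ffunP E; have := E o0; rewrite !ffunE /= => -[-> _ ->].
by congr (_, (_, _)); apply/ffunP => i; have := E i; rewrite !ffunE /= => -[].
Qed.

Definition weight : nat := (\sum_(i < 4) wt i)%N.

Lemma aligned_term g sg v : admissible sg -> v != zerovec m ->
  pattern_term (aligned (g, (sg, v))) = - (mu ^+ 4 * eps ^+ weight *
   (vec_weight R v * complex.Re (chi w ((encode D v)%:~R *
    (d ^+ 2 * (B ^+ g * \sum_i c (sg i) * k i ^+ 2)%:~R
      + d * (B ^+ (2 * g) * \sum_i lam (sg i) * k i)%:~R))))).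
Proof.
case/and5P => /eqP n1 /eqP n3 /eqP nw /eqP c0 /andP [/eqP ck0 /eqP l0] v0.
rewrite /pattern_term /quad_sum /moment_sum /lin_sum.
have quadE (F : 'I_4 -> int) : \sum_i quad (aligned (g, (sg, v)) i) * F i =
    encode D v * (B ^+ g * \sum_i c (sg i) * F i).
  rewrite !mulr_sumr; apply: eq_bigr => i _; rewrite ffunE /quad_freq /=.
  by rewrite -!mulrA; rewrite [in LHS]mulrCA.
have linE (F : 'I_4 -> int) : \sum_i lin (aligned (g, (sg, v)) i) * F i =
    encode D v * (B ^+ (2 * g) * \sum_i lam (sg i) * F i).
  rewrite !mulr_sumr; apply: eq_bigr => i _; rewrite ffunE /lin_freq /=.
  by rewrite -!mulrA; rewrite [in LHS]mulrCA.
have -> : \sum_i quad (aligned (g, (sg, v)) i) = 0.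
  rewrite (eq_bigr (fun i => quad (aligned (g, (sg, v)) i) * 1)) => [|i _]; last by rewrite mulr1.
  rewrite (quadE (fun=> 1)) (eq_bigr (fun i => c (sg i))) => [|i _]; last by rewrite mulr1.
  by rewrite c0 !mulr0.
have -> : \sum_i lin (aligned (g, (sg, v)) i) = 0.
  rewrite (eq_bigr (fun i => lin (aligned (g, (sg, v)) i) * 1)) => [|i _]; last by rewrite mulr1.
  rewrite (linE (fun=> 1)) (eq_bigr (fun i => lam (sg i))) => [|i _]; last by rewrite mulr1.
  by rewrite l0 !mulr0.
rewrite quadE ck0 !mulr0 !addr0 gauss_const // (quadE (fun i => k i ^+ 2)) linE.
have -> : pattern_coef (aligned (g, (sg, v))) = - (mu ^+ 4 * eps ^+ weight * vec_weight R v).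
  rewrite /pattern_coef (eq_bigr (fun i => mu * (-1) ^+ (sg i == o1) * eps ^+ wt (sg i) *
     (vec_weight R v) ^+ (sg i == o3))); last first.
    move=> i _; rewrite ffunE /= (negbTE v0).
    by case: (sg i == o1); case: (sg i == o3); rewrite ?expr1 ?expr0.
  rewrite !big_split /= prodr_const card_ord !prodrXr n1 n3 nw.
  by rewrite !expr1 mulrN1 !mulNr.
rewrite mulNr; congr (- _); rewrite -[LHS]mulrA; congr (_ * (_ * complex.Re (chi w _))).
by rewrite !rmorphM /=; ring.
Qed.

(** For each scale and each [sg] the sum over nonzero [v] is a Riesz product minus its constant
    term: at least [-1] always, and [2^m - 1] for the identity. *)
Lemma aligned_sum_bound :
  \sum_(a in aligned_index) pattern_term (aligned a) <=
  - (G%:R * (mu ^+ 4 * eps ^+ weight * (2 ^+ m - 1 - #|{ffun 'I_4 -> 'I_4}|%:R))).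
Proof.
pose S g sg := \sum_(v : signvec m | v != zerovec m) vec_weight R v *
   complex.Re (chi w ((encode D v)%:~R *
    (d ^+ 2 * (B ^+ g * \sum_i c (sg i) * k i ^+ 2)%:~R
      + d * (B ^+ (2 * g) * \sum_i lam (sg i) * k i)%:~R))).
have E : \sum_(a in aligned_index) pattern_term (aligned a) =
   \sum_(g < G) - (mu ^+ 4 * eps ^+ weight *
       \sum_(sg : {ffun 'I_4 -> 'I_4} | admissible sg) S g sg).
  rewrite (eq_bigl (fun a => true && (admissible a.2.1 && (a.2.2 != zerovec m)))); last first.
    by move=> a; rewrite inE.
  rewrite -(pair_big xpredT (fun b : {ffun 'I_4 -> 'I_4} * signvec m =>
     admissible b.1 && (b.2 != zerovec m)) (fun g b => pattern_term (aligned (g, b)))) /=.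
  apply: eq_bigr => g _.
  rewrite -(pair_big admissible (fun v => v != zerovec m)
     (fun sg v => pattern_term (aligned (g, (sg, v))))) /=.
  have NM (I : finType) (Q : pred I) (a : R) (F : I -> R) :
      - (a * \sum_(i | Q i) F i) = \sum_(i | Q i) - (a * F i) by rewrite mulr_sumr sumrN.
  rewrite NM; apply: eq_bigr => sg asg; rewrite NM; apply: eq_bigr => v v0.
  exact: aligned_term.
have GM (a : R) : G%:R * a = \sum_(g < G) a by rewrite sumr_const card_ord mulr_natl.
rewrite {}E sumrN lerN2 GM.
apply: ler_sum => g _; apply: ler_wpM2l; first by rewrite mulr_ge0 ?exprn_ge0.
have SE sg : S g sg = \sum_(v : signvec m) vec_weight R v *
   complex.Re (chi w ((encode D v)%:~R *
    (d ^+ 2 * (B ^+ g * \sum_i c (sg i) * k i ^+ 2)%:~R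
      + d * (B ^+ (2 * g) * \sum_i lam (sg i) * k i)%:~R))) - 1.
  rewrite [in RHS](bigD1 (zerovec m)) //= vec_weight0 mul1r.
  have -> : encode D (zerovec m) = 0.
    by rewrite /encode big1 // => r _; rewrite ffunE mulr0.
  by rewrite mul0r chi0 /= addrAC subrr add0r.
have Sge sg : -1 <= S g sg.
  by rewrite SE -subr_ge0 opprK subrK; apply: weighted_character_sum_ge0.
pose id4 : {ffun 'I_4 -> 'I_4} := [ffun i => i].
case: LD => _ _ [c0 ck0 ckk0 l0 lk0] _.
have adm : admissible id4.
  have r (V : nmodType) (F : 'I_4 -> 'I_4 -> V) : \sum_i F (id4 i) i = \sum_i F i i.
    by apply: eq_bigr => i _; rewrite ffunE.
  have rn (F : 'I_4 -> nat) : (\sum_(i < 4) F (id4 i) = \sum_(i < 4) F i)%N.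
    by apply: eq_bigr => i _; rewrite ffunE.
  rewrite /admissible (rn (fun s => s == o1 : nat)) (rn (fun s => s == o3 : nat)) (rn wt) !sum4n eqxx.
  rewrite (r _ (fun s _ => c s)) (r _ (fun s i => c s * k i)) (r _ (fun s _ => lam s)).
  by rewrite c0 ck0 l0 !eqxx.
rewrite (bigD1 id4) //=.
have -> : S g id4 = 2 ^+ m - 1.
  rewrite SE -(total_vec_weight m R); congr (_ - 1); apply: eq_bigr => v _.
  have -> : \sum_i c (id4 i) * k i ^+ 2 = 0.
    by rewrite -[RHS]ckk0; apply: eq_bigr => i _; rewrite ffunE.
  have -> : \sum_i lam (id4 i) * k i = 0.
    by rewrite -[RHS]lk0; apply: eq_bigr => i _; rewrite ffunE.
  by rewrite !mulr0 addr0 mulr0 chi0 mulr1.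
rewrite lerD2l; apply: (@le_trans _ _ (\sum_(sg | admissible sg && (sg != id4)) (-1 : R))).
  rewrite sumr_const mulNrn lerN2 ler_nat; exact: max_card.
by apply: ler_sum => sg _; exact: Sge.
Qed.

Definition group_patterns (g : 'I_G) : {set pattern} :=
  [set X : pattern | [forall i, (X i != None) ==> (atom_group (X i) == Some g)]].

Definition local_count : nat := #|{ffun 'I_4 -> option ('I_4 * signvec m)}|.

Lemma card_group_patterns g : (#|group_patterns g| <= local_count)%N.
Proof.
pose proj (X : pattern) : {ffun 'I_4 -> option ('I_4 * signvec m)} :=
  [ffun i => omap snd (X i)].
have inj : {in group_patterns g &, injective proj}.
  move=> X X'; rewrite !inE => /forallP HX /forallP HX' /ffunP E; apply/ffunP => i.
  have := E i; have := HX i; have := HX' i; rewrite !ffunE.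
  case: (X i) => [[h sv]|]; case: (X' i) => [[h' sv']|] //=.
  by move=> /eqP [->] /eqP [->] [->].
by rewrite -(card_in_imset inj); exact: max_card.
Qed.

Definition exceptional_patterns : {set pattern} :=
  [set X : pattern | [&& [forall i, active (X i)], quad_sum X == 0, lin_sum X != 0 &
     2 * d * (moment_sum X)%:~R + (lin_sum X)%:~R == 0 :> 'Z_N]].

Lemma pattern_group (X : pattern) : (forall i, active (X i)) -> X != trivial_pattern ->
  quad_sum X = 0 -> 2 * d * (moment_sum X)%:~R + (lin_sum X)%:~R = 0 :> 'Z_N ->
  (lin_sum X = 0 -> moment_sum X = 0) /\ exists g, X \in group_patterns g.
Proof.
move=> actX Xnt U0 V0.
have LP : lin_sum X = 0 -> moment_sum X = 0.
  move=> L0; move: V0; rewrite L0 addr0 => V0; have [V1|] := Zp_mulf_eq0 N_prime V0.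
    have [E|E] := Zp_mulf_eq0 N_prime V1; first by move: two_neq0; rewrite E eqxx.
    by move: d_neq0; rewrite E eqxx.
  exact: intr_Zp_eq0.
split=> //.
have [i0 Xi0] : exists i, X i != None.
  apply/existsP; apply: contraR Xnt; rewrite negb_exists => /forallP H.
  by apply/eqP/ffunP => i; rewrite ffunE; apply/eqP; have := H i; rewrite negbK.
have [g gi0] : exists g, atom_group (X i0) = Some g.
  by case: (X i0) Xi0 => [[g sv]|] // _; exists g.
exists g; rewrite inE; apply/forallP => i; apply/implyP => Xi.
have [h hi] : exists g, atom_group (X i) = Some g.
  by case: (X i) Xi => [[h sv]|] // _; exists h.
by rewrite hi (single_group LD D_gt0 D_c D_ck actX U0 LP gi0 hi).
Qed.

(** Eliminating [d] between two exceptional patterns gives a proportionality modulo [N], hence over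
    the integers by [cross_small], so all of them live at one scale. The bound is independent of
    [G]. *)
Lemma card_exceptional_patterns : (#|exceptional_patterns| <= local_count)%N.
Proof.
have [->|[X0 X0E]] := set_0Vmem exceptional_patterns; first by rewrite cards0.
have data X : X \in exceptional_patterns -> [/\ forall i, active (X i), quad_sum X = 0,
   lin_sum X != 0, 2 * d * (moment_sum X)%:~R + (lin_sum X)%:~R = 0 :> 'Z_N & X != trivial_pattern].
  rewrite inE => /and4P [/forallP ? /eqP ? L0 /eqP ?]; split=> //.
  apply: contraNneq L0 => ->; rewrite /lin_sum big1 // => i _.
  by rewrite ffunE.
have mom X : X \in exceptional_patterns -> moment_sum X != 0.
  case/data => _ _ L0 V0 _; apply: contraNneq L0 => P0; apply/eqP.
  by apply: (intr_Zp_eq0 N_prime (lin_small X)); rewrite -[RHS]V0 P0 mulr0 add0r.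
have [act0 U0 L0 V0 nt0] := data _ X0E.
have [_ [g X0g]] := pattern_group act0 nt0 U0 V0.
apply: leq_trans (card_group_patterns g); apply/subset_leq_card/subsetP => X XE.
have [actX UX LX VX ntX] := data _ XE.
have [_ [h Xh]] := pattern_group actX ntX UX VX.
suff -> : g = h by [].
have grp Y l : Y \in group_patterns l -> forall i, Y i != None -> atom_group (Y i) = Some l.
  by rewrite inE => /forallP H i Yi; have := H i; rewrite Yi => /eqP.
apply: (exceptional_group_unique D_gt0 D_ck D_lam (grp _ _ X0g) (grp _ _ Xh)) => //.
- exact: mom.
- exact: mom.
apply/eqP; rewrite -subr_eq0; apply/eqP.
apply: (intr_Zp_eq0 N_prime (cross_small X0 X)).
have tdn0 : 2 * d != 0.
  apply/eqP => V1; have [E|E] := Zp_mulf_eq0 N_prime V1.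
    by move: two_neq0; rewrite E eqxx.
  by move: d_neq0; rewrite E eqxx.
have : 2 * d * (moment_sum X0 * lin_sum X - moment_sum X * lin_sum X0)%:~R = 0 :> 'Z_N.
  have e0 : 2 * d * (moment_sum X0)%:~R = - (lin_sum X0)%:~R by apply/eqP; rewrite -addr_eq0 V0.
  have e1 : 2 * d * (moment_sum X)%:~R = - (lin_sum X)%:~R by apply/eqP; rewrite -addr_eq0 VX.
  rewrite rmorphB /= !rmorphM /= mulrBr !mulrA e0 e1.
  by ring.
by move=> V1; have [E|//] := Zp_mulf_eq0 N_prime V1; rewrite E eqxx in tdn0.
Qed.

(** The three terms account for a nonzero quadratic sum, a relation special to this [d], and an
    accident inside one scale. *)
Lemma pattern_term_bound (X : pattern) : X != trivial_pattern ->
  X \notin aligned @: aligned_index ->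
  pattern_term X <= delta * `|pattern_coef X| + (X \in exceptional_patterns)%:R * mu ^+ 3
    + \sum_g (X \in group_patterns g)%:R * (mu ^+ 4 * eps ^+ weight.+1).
Proof.
move=> Xnt Xna.
have ge1 : 0 <= delta * `|pattern_coef X| by rewrite mulr_ge0.
have ge2 : 0 <= (X \in exceptional_patterns)%:R * mu ^+ 3 by rewrite mulr_ge0 ?ler0n ?exprn_ge0.
have ge3 : 0 <= \sum_g (X \in group_patterns g)%:R * (mu ^+ 4 * eps ^+ weight.+1).
  by apply: sumr_ge0 => g _; rewrite mulr_ge0 ?ler0n ?mulr_ge0 ?exprn_ge0.
have ge0 := addr_ge0 (addr_ge0 ge1 ge2) ge3.
have termE : pattern_term X = pattern_coef X * gauss w (quad_sum X)%:~R
      (2 * d * (moment_sum X)%:~R + (lin_sum X)%:~R)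
      (d ^+ 2 * (\sum_(i < 4) quad (X i) * k i ^+ 2)%:~R
       + d * (\sum_(i < 4) lin (X i) * k i)%:~R) by [].
case: (boolP [forall i, active (X i)]) => [/forallP actX|]; last first.
  rewrite negb_forall => /existsP [i ni].
  suff E : pattern_coef X = 0 by rewrite termE {1}E mul0r.
  rewrite /pattern_coef (bigD1 i) //=.
  have -> : coef (X i) = 0 by apply/eqP; apply: contraR ni; exact: coef_active.
  by rewrite mul0r.
have absM (y : R) : pattern_coef X * y <= `|pattern_coef X| * `|y|.
  by rewrite -normrM ler_norm.
have [U0|U0] := eqVneq ((quad_sum X)%:~R : 'Z_N) 0; last first.
  rewrite termE; apply: le_trans (absM _) _; rewrite -addrA -[leLHS]addr0 lerD ?addr_ge0 //.
  by rewrite mulrC ler_wpM2r // gauss_quadratic.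
have [V0|V0] := eqVneq (2 * d * (moment_sum X)%:~R + (lin_sum X)%:~R : 'Z_N) 0; last first.
  by rewrite termE U0 gauss_linear // mulr0.
have quad0 : quad_sum X = 0 by apply: (intr_Zp_eq0 N_prime).
have [LP [g Xg]] := pattern_group actX Xnt quad0 V0.
have X_group i : X i != None -> atom_group (X i) = Some g.
  by move: Xg; rewrite inE => /forallP /(_ i) /implyP H /H /eqP.
have termK : pattern_term X <= `|pattern_coef X|.
  by rewrite termE; apply: le_trans (absM _) _; rewrite ler_piMr // gauss_le1.
have [L0|L0] := eqVneq (lin_sum X) 0; last first.
  have XE : X \in exceptional_patterns.
    by rewrite inE quad0 L0 V0 !eqxx !andbT; apply/forallP.
  have := ge1; have := ge3; rewrite XE mul1r => ? ?.
  suff : `|pattern_coef X| <= mu ^+ 3 by move: termK; lra.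
  have sup := support_ge3 LD D_gt0 D_c actX quad0 L0
     (single_group LD D_gt0 D_c D_ck actX quad0 LP).
  rewrite /pattern_coef normr_prod; apply: (@le_trans _ _ (mu ^+ #|[set i | X i != None]|)).
    apply: (@le_trans _ _ (\prod_i (if X i != None then mu else 1))).
      by apply: ler_prod => i _; rewrite normr_ge0 norm_coef_le_mu.
    by rewrite -big_mkcond /= prodr_const -cardsE.
  by rewrite ler_wiXn2l.
have ex : exists i, X i != None.
  apply/existsP; apply: contraR Xnt; rewrite negb_exists => /forallP H.
  by apply/eqP/ffunP => i; rewrite ffunE; apply/eqP; have := H i; rewrite negbK.
case: (permanent_pattern LD D_gt0 D_c D_ck D_lam actX quad0 X_group ex (LP L0) L0).
  case=> sg [v [v0 XE [n1 n3 nw] [c0 ck0 l0]]]; case/negP: Xna; apply/imsetP.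
  exists (g, ([ffun i => sg i], v)).
    have r (V : nmodType) (F : 'I_4 -> 'I_4 -> V) :
        \sum_i F ([ffun i => sg i] i) i = \sum_i F (sg i) i.
      by apply: eq_bigr => i _; rewrite ffunE.
    have rn (F : 'I_4 -> nat) : (\sum_(i < 4) F ([ffun i => sg i] i) = \sum_(i < 4) F (sg i))%N.
      by apply: eq_bigr => i _; rewrite ffunE.
    rewrite inE /= v0 andbT /admissible (rn (fun s => s == o1 : nat)) (rn (fun s => s == o3 : nat)).
    rewrite (rn wt) n1 n3 nw !eqxx.
    rewrite (r _ (fun s _ => c s)) (r _ (fun s i => c s * k i)) (r _ (fun s _ => lam s)).
    by rewrite c0 ck0 l0 !eqxx.
  by apply/ffunP => i; rewrite !ffunE /= XE.
case=> allX wlt.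
have K : `|pattern_coef X| <= mu ^+ 4 * eps ^+ weight.+1.
  rewrite /pattern_coef normr_prod.
  apply: (@le_trans _ _ (\prod_i (mu * eps ^+ wt (atom_char (X i))))).
    apply: ler_prod => i _; rewrite normr_ge0 /=; have := allX i.
    by case: (X i) => [[h [s v]]|] // _; exact: norm_coef_some.
  rewrite big_split /= prodr_const card_ord prodrXr ler_wpM2l ?exprn_ge0 //.
  by rewrite ler_wiXn2l.
have h3 : mu ^+ 4 * eps ^+ weight.+1 <=
    \sum_g (X \in group_patterns g)%:R * (mu ^+ 4 * eps ^+ weight.+1).
  rewrite (bigD1 g) //= Xg mul1r lerDl; apply: sumr_ge0 => h _.
  by rewrite mulr_ge0 ?ler0n ?mulr_ge0 ?exprn_ge0.
by move: termK K h3 ge1 ge2; lra.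
Qed.

Theorem correlation_bound :
  expectation (fun t : 'Z_N => \prod_(i < 4) trig_poly w coef quad lin (t + (k i)%:~R * d))
  <= 1 - G%:R * (mu ^+ 4 * eps ^+ weight * (2 ^+ m - 1 - #|{ffun 'I_4 -> 'I_4}|%:R))
     + delta * \sum_X `|pattern_coef X| + local_count%:R * mu ^+ 3
     + G%:R * (local_count%:R * (mu ^+ 4 * eps ^+ weight.+1)).
Proof.
have := aligned_sum_bound; set main := (G%:R * (_ * (_ - _))) => aligned_le.
rewrite correlation_pattern_sum (bigD1 trivial_pattern) //= trivial_pattern_term -!addrA lerD2l.
rewrite (bigID (fun X => X \in aligned @: aligned_index)) /= !addrA.
have -> : \sum_(X | (X != trivial_pattern) && (X \in aligned @: aligned_index)) pattern_term X
    = \sum_(a in aligned_index) pattern_term (aligned a).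
  rewrite -(big_imset pattern_term (in2W aligned_inj)) /=; apply: eq_bigl => X.
  case: (boolP (X \in _)) => [/imsetP [a _ ->]|]; rewrite ?andbF // andbT.
  by apply/eqP => /ffunP /(_ o0); rewrite !ffunE.
rewrite -!addrA; apply: lerD; first exact: aligned_le.
apply: (@le_trans _ _ (\sum_(X : pattern) (delta * `|pattern_coef X| +
   (X \in exceptional_patterns)%:R * mu ^+ 3
    + \sum_g (X \in group_patterns g)%:R * (mu ^+ 4 * eps ^+ weight.+1)))).
  rewrite big_mkcond; apply: ler_sum => X _; case: ifP => [/andP [X0 Xa]|_].
    exact: pattern_term_bound.
  rewrite !addr_ge0 ?mulr_ge0 ?ler0n ?exprn_ge0 //.
  by apply: sumr_ge0 => g _; rewrite mulr_ge0 ?ler0n ?mulr_ge0 ?exprn_ge0.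
rewrite !big_split /= -mulr_sumr -mulr_suml -natr_sum -!addrA lerD2l.
have cnt (S : {set pattern}) : (\sum_X (X \in S : nat) = #|S|)%N.
  by rewrite -sum1_card [RHS]big_mkcond /=; apply: eq_bigr => X _; case: (X \in S).
apply: lerD.
  by rewrite cnt ler_wpM2r ?exprn_ge0 // ler_nat card_exceptional_patterns.
rewrite exchange_big /= mulr_natl -[X in _ <= _ *+ X]card_ord -sumr_const; apply: ler_sum => g _.
rewrite -mulr_suml -natr_sum cnt ler_wpM2r ?mulr_ge0 ?exprn_ge0 //.
by rewrite ler_nat card_group_patterns.
Qed.

End FixedDifference.

Definition pert_coef (x : option atom) : R := if x is None then 0 else coef x.

Lemma pert_coef_opp x : pert_coef (opp_atom x) = pert_coef x.
Proof. by have := coef_opp x; case: x => [[g [s v]]|]. Qed.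

Lemma norm_pert_coef x : `|pert_coef x| <= (x != None)%:R * mu.
Proof.
case: x => [x|] /=; last by rewrite normr0 mul0r.
by rewrite mul1r; exact: (norm_coef_le_mu (Some x)).
Qed.

Lemma trig_poly_pert (t : 'Z_N) :
  trig_poly w coef quad lin t = 1 + trig_poly w pert_coef quad lin t.
Proof.
rewrite /trig_poly (bigD1 None) //= [in RHS](bigD1 None) //= mul0r add0r.
rewrite mulr1; congr (_ + _).
by apply: eq_bigr => -[x|].
Qed.

Lemma sum_pert_coef : \sum_x `|pert_coef x| <= #|{: atom}|%:R * mu.
Proof.
apply: le_trans (ler_sum _ (fun x _ => norm_pert_coef x)) _.
rewrite -mulr_suml -natr_sum ler_wpM2r // ler_nat.
rewrite (bigD1 None) //= add0n (eq_bigr (fun=> 1%N)) => [|x -> //].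
by rewrite sum1_card cardC1 card_option.
Qed.

(** * Mean and eighth moment of the perturbation *)

Section Moments.
Variable delta : R.
Hypothesis N_gt2 : (2 < N)%N.
Hypothesis delta_ge0 : 0 <= delta.
Hypothesis delta_N : (N%:R)^-1 <= delta ^+ 2.

Let two_neq0 : (2 : 'Z_N) != 0.
Proof.
apply/eqP => E; have := @intr_Zp_eq0 N 2 N_prime _ E.
by rewrite normr_nat; move: N_gt2; rewrite -ltz_nat => -> /(_ isT).
Qed.

(** The correlation expansion at [d = 0]. The remaining phases stay unspecified, since the moment
    bounds look only at the quadratic coefficient. *)
Lemma power_expansion n : exists V Z : {ffun 'I_n -> option atom} -> 'Z_N,
  expectation (fun t : 'Z_N => trig_poly w pert_coef quad lin t ^+ n) =
  \sum_(X : {ffun 'I_n -> option atom}) (\prod_(i < n) pert_coef (X i)) *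
    gauss w (\sum_(i < n) quad (X i))%:~R (V X) (Z X).
Proof.
have := correlation_expansion N_prime w_prim (@opp_atomK m G) pert_coef_opp
  (frequency_opp D (fun g => B ^+ g) c) (frequency_opp D (fun g => B ^+ (2 * g)) lam)
  (fun _ : 'I_n => 0) 0.
move=> E.
exists (fun X => 2 * 0 * (\sum_(i < n) quad (X i) * 0)%:~R + (\sum_(i < n) lin (X i))%:~R).
exists (fun X => 0 ^+ 2 * (\sum_(i < n) quad (X i) * 0 ^+ 2)%:~R
       + 0 * (\sum_(i < n) lin (X i) * 0)%:~R).
rewrite -[RHS]E.
rewrite /expectation; congr (_ / _); apply: eq_bigr => t _.
rewrite (eq_bigr (fun=> trig_poly w pert_coef quad lin t)) => [|i _]; last by rewrite mulr0 addr0.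
by rewrite prodr_const card_ord.
Qed.

Lemma mean_bound : (forall x, `|quad x| < N%:Z) ->
  `|expectation (fun t : 'Z_N => trig_poly w pert_coef quad lin t)| <=
    delta * \sum_(X : {ffun 'I_1 -> option atom}) `|\prod_(i < 1) pert_coef (X i)|.
Proof.
move=> small.
have -> : expectation (fun t : 'Z_N => trig_poly w pert_coef quad lin t) =
    expectation (fun t : 'Z_N => trig_poly w pert_coef quad lin t ^+ 1) by [].
have [V [Z ->]] := power_expansion 1; apply: le_trans (ler_norm_sum _ _ _) _.
rewrite mulr_sumr; apply: ler_sum => X _; rewrite normrM mulrC.
have -> : \prod_(i < 1) pert_coef (X i) = pert_coef (X ord0) by rewrite big_ord1.
case: (boolP (pert_coef (X ord0) == 0)) => [/eqP ->|nz].
  by rewrite normr0 !mulr0.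
apply: ler_wpM2r => //; apply: gauss_quadratic => //.
apply/eqP => /(intr_Zp_eq0 N_prime); rewrite big_ord1 => /(_ (small _)).
move: nz; rewrite /pert_coef; case: (X ord0) => [[g [s v]]|]; last by rewrite eqxx.
move=> nz q0; have act := coef_active nz.
have E : \sum_(i < 1) frequency D (fun g => B ^+ g) c (Some (g, (s, v))) = 0 by rewrite big_ord1.
have dg := @digit_eq0 m G D 1 (fun=> Some (g, (s, v))) B (fun _ => c) D_gt0 isT
  (D_pow_le_big_base m D_gt0) (fun _ => D_c) E g.
have [j] := digit_singleton LD (X := fun _ : 'I_1 => Some (g, (s, v))) (i := ord0) act erefl dg.
by rewrite ord1.
Qed.

(** Up to the [delta] term only patterns with vanishing quadratic sum count; in those no scale
    occurs once, so there are [O(G^4)] of them. *)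
Lemma eighth_moment_bound :
  (forall X : {ffun 'I_8 -> option atom}, `|\sum_i quad (X i)| < N%:Z) ->
  expectation (fun t : 'Z_N => trig_poly w pert_coef quad lin t ^+ 8) <=
   (4 ^ 8 * (G ^ 4 * #|{: 'I_4 * signvec m}| ^ 8))%:R * mu ^+ 8
   + delta * \sum_(X : {ffun 'I_8 -> option atom}) `|\prod_(i < 8) pert_coef (X i)|.
Proof.
move=> small.
pose S : {set {ffun 'I_8 -> option atom}} :=
  [set X : {ffun 'I_8 -> option atom} | [forall i, (X i != None) && active (X i)] && (\sum_i quad (X i) == 0)].
have cardS : (#|S| <= 4 ^ 8 * (G ^ 4 * #|{: 'I_4 * signvec m}| ^ 8))%N.
  apply: card_no_singletons => X; rewrite inE => /andP [/forallP act /eqP q0] i.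
  have /andP [Xi ai] := act i.
  have dg := @digit_eq0 m G D 8 X B (fun _ => c) D_gt0 isT
    (D_pow_le_big_base m D_gt0) (fun _ => D_c) q0.
  have [g gi] : exists g, atom_group (X i) = Some g.
    by case: (X i) Xi => [[g sv]|] // _; exists g.
  have [j ji gj] := digit_singleton LD ai gi (dg g).
  have om (x : option atom) : atom_group x = omap fst x by case: x => [[]|].
  by exists g, j; split; rewrite -?om.
have [V [Z ->]] := power_expansion 8.
apply: (@le_trans _ _ (\sum_(X : {ffun 'I_8 -> option atom})
   ((X \in S)%:R * mu ^+ 8 + delta * `|\prod_(i < 8) pert_coef (X i)|))).
  apply: ler_sum => X _; set K := \prod_(i < 8) pert_coef (X i).
  have absM (y : R) : K * y <= `|K| * `|y| by rewrite -normrM ler_norm.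
  have [U0|U0] := eqVneq ((\sum_(i < 8) quad (X i))%:~R : 'Z_N) 0; last first.
    apply: le_trans (absM _) _; rewrite -[leLHS]add0r lerD ?mulr_ge0 ?ler0n ?exprn_ge0 //.
    by rewrite mulrC; apply: ler_wpM2r => //; exact: gauss_quadratic.
  have q0 := intr_Zp_eq0 N_prime (small X) U0.
  apply: le_trans (absM _) _; rewrite -[leLHS]addr0 lerD ?mulr_ge0 //.
  apply: (@le_trans _ _ `|K|); first by rewrite ler_piMr // gauss_le1.
  case: (boolP (X \in S)) => XS.
    have -> : mu ^+ 8 = \prod_(i < 8) mu by rewrite prodr_const card_ord.
    rewrite mul1r /K normr_prod; apply: ler_prod => i _.
    rewrite normr_ge0 /=; apply: le_trans (norm_pert_coef _) _.
    by case: (X i != None); rewrite ?mul1r ?mul0r.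
  rewrite mul0r normr_le0 /K; move: XS; rewrite inE q0 eqxx andbT negb_forall.
  case/existsP => i; rewrite negb_and negbK => ni; rewrite (bigD1 i) //=.
  suff -> : pert_coef (X i) = 0 by rewrite mul0r.
  case/orP: ni => [/eqP -> //|ni]; rewrite /pert_coef; case E : (X i) => [x|//].
  by rewrite -E; apply/eqP; apply: contraR ni; exact: coef_active.
rewrite big_split /= -mulr_suml -natr_sum -mulr_sumr lerD2r.
rewrite ler_wpM2r ?exprn_ge0 // ler_nat; apply: leq_trans cardS.
by rewrite -sum1_card [leqRHS]big_mkcond /=; apply: leq_sum => X _; case: (X \in S).
Qed.

End Moments.

End CorrelationBound.

(** * Truncation and choice of parameters *)

Section Expectation.
Variables (R : realType) (T : finType).
Hypothesis T_gt0 : (0 < #|T|)%N.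
Implicit Types F H : T -> R.

Lemma eq_expectation F H : F =1 H -> expectation F = expectation H.
Proof. by move=> E; rewrite /expectation (eq_bigr _ (fun t _ => E t)). Qed.

Lemma ler_expectation F H : (forall t, F t <= H t) -> expectation F <= expectation H.
Proof.
by move=> E; rewrite /expectation ler_wpM2r ?invr_ge0 ?ler0n //; apply: ler_sum.
Qed.

Lemma expectationD F H : expectation (fun t => F t + H t) = expectation F + expectation H.
Proof. by rewrite /expectation big_split mulrDl. Qed.

Lemma expectationZ (a : R) F : expectation (fun t => a * F t) = a * expectation F.
Proof. by rewrite /expectation -mulr_sumr mulrA. Qed.

Lemma expectation_cst (a : R) : expectation (fun _ : T => a) = a.
Proof.
rewrite /expectation sumr_const -[_ *+ _]mulr_natr -mulrA divff ?mulr1 //.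
by rewrite pnatr_eq0 -lt0n.
Qed.

Lemma expectation_sum n (F : 'I_n -> T -> R) :
  expectation (fun t => \sum_i F i t) = \sum_i expectation (F i).
Proof. by rewrite /expectation exchange_big /= mulr_suml. Qed.

Lemma norm_expectation F : `|expectation F| <= expectation (fun t => `|F t|).
Proof.
rewrite /expectation normrM [X in _ * X]ger0_norm ?invr_ge0 ?ler0n //.
by rewrite ler_wpM2r ?invr_ge0 ?ler0n // ler_norm_sum.
Qed.

End Expectation.

Lemma expectation_shift (R : realType) (N : nat) (F : 'Z_N -> R) (s : 'Z_N) :
  expectation (fun t => F (t + s)) = expectation F.
Proof. by rewrite /expectation [in RHS](reindex_inj (addIr s)). Qed.

Lemma norm_prod_sub (R : realType) n (u v : 'I_n -> R) (L : R) : 1 <= L ->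
  (forall i, `|u i| <= L) -> (forall i, `|v i| <= L) ->
  `|\prod_i u i - \prod_i v i| <= L ^+ n * \sum_i `|u i - v i|.
Proof.
move=> L1; have L0 : 0 <= L by exact: le_trans L1.
elim: n u v => [|n IHn] u v uL vL; first by rewrite !big_ord0 subrr normr0 mulr0.
rewrite !big_ord_recl; set U := \prod_(i < n) _; set V := \prod_(i < n) _.
set S := \sum_(i < n) _.
have UL : `|U| <= L ^+ n.
  rewrite /U normr_prod -[X in L ^+ X](card_ord n) -prodr_const.
  by apply: ler_prod => i _; rewrite normr_ge0 uL.
have UV : `|U - V| <= L ^+ n * S by apply: IHn => i.
have -> : u ord0 * U - v ord0 * V = (u ord0 - v ord0) * U + v ord0 * (U - V) by ring.
apply: le_trans (ler_normD _ _) _; rewrite !normrM mulrDr lerD //.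
  rewrite mulrC; apply: ler_wpM2r => //; apply: le_trans UL _.
  by rewrite exprS ler_peMl // exprn_ge0.
by rewrite exprS -mulrA ler_pM.
Qed.

Section Truncation.
Variable R : realType.
Local Notation half := (2^-1 : R).

Definition clip (x : R) : R := Num.max (- half) (Num.min half x).

Lemma clip_norm x : `|clip x| <= half.
Proof.
have h0 : 0 <= half by rewrite invr_ge0 ler0n.
rewrite /clip; have [hx|hx] := leP half x.
  by rewrite max_r ?ger0_norm //; move: h0; lra.
have [xh|xh] := leP (- half) x; first by rewrite ler_norml xh ltW.
by rewrite normrN ger0_norm.
Qed.

(** The error vanishes on [[-1/2, 1/2]]; beyond it [(2 |x|)^7 >= 1], so [|x|] is at most
    [2^7 x^8]. *)
Lemma clip_error x : `|x - clip x| <= 2 ^+ 7 * x ^+ 8.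
Proof.
have h0 : 0 < half by rewrite invr_gt0 ltr0n.
have big y : half <= y -> y <= 2 ^+ 7 * y ^+ 8.
  move=> hy; have y0 : 0 <= y by apply: le_trans hy; exact: ltW.
  rewrite [y ^+ 8]exprS mulrCA -exprMn ler_peMr // exprn_ege1 //.
  by rewrite -ler_pdivrMl ?ltr0n // mulr1.
have e0 : 0 <= 2 ^+ 7 * x ^+ 8.
  by apply: mulr_ge0; [rewrite exprn_ge0 | apply: exprn_even_ge0].
rewrite /clip; have [hx|hx] := leP half x.
  rewrite max_r; last by move: h0; lra.
  rewrite ger0_norm ?subr_ge0 //; apply: le_trans (big _ hx); move: h0; lra.
have [xh|xh] := leP (- half) x.
  by rewrite subrr normr0.
rewrite ler0_norm; last by move: xh; lra.
have -> : x ^+ 8 = (- x) ^+ 8 by ring.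
by apply: le_trans (big (- x) _); move: xh h0; lra.
Qed.

(** The witness is [1 + clip h - E (clip h)]: subtracting the mean makes the expectation exactly
    [1], and both corrections are at most [1/2]. The upper bound [2] is what [alpha < 1/2] can
    absorb. *)
Lemma truncation (N : nat) (h : 'Z_N -> R) (M : R) : 1 <= M -> (forall t, `|h t| <= M) ->
  exists g : 'Z_N -> R, [/\ forall t, 0 <= g t <= 2, expectation g = 1 &
    forall s : 'I_4 -> 'Z_N, expectation (fun t => \prod_i g (t + s i)) <=
      expectation (fun t => \prod_i (1 + h (t + s i))) + (M + 1) ^+ 4 *
      (4 * (2 * (2 ^+ 7 * expectation (fun t => h t ^+ 8)) + `|expectation h|))].
Proof.
move=> M1 hM.
have T0 : (0 < #|'Z_N|)%N by rewrite card_ord.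
pose a := expectation (fun t => clip (h t)).
pose eta := 2 ^+ 7 * expectation (fun t => h t ^+ 8).
have err : expectation (fun t => `|h t - clip (h t)|) <= eta.
  by rewrite /eta -expectationZ; apply: ler_expectation => t; exact: clip_error.
have a_half : `|a| <= half.
  apply: le_trans (norm_expectation _) _; rewrite -[leRHS](expectation_cst T0).
  by apply: ler_expectation => t; exact: clip_norm.
have a_le : `|a| <= `|expectation h| + eta.
  have -> : a = expectation h - expectation (fun t => h t - clip (h t)).
    rewrite -mulN1r -expectationZ -expectationD; apply: eq_expectation => t.
    by rewrite mulN1r opprB addrC subrK.
  apply: le_trans (ler_normB _ _) _; rewrite lerD2l; apply: le_trans err.
  exact: norm_expectation.
exists (fun t => 1 + clip (h t) - a).
have bnd t : `|clip (h t) - a| <= 1.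
  by apply: le_trans (ler_normB _ _) _; have := clip_norm (h t); move: a_half; lra.
split.
- by move=> t; have := bnd t; rewrite ler_norml => /andP [? ?]; apply/andP; split; lra.
- rewrite expectationD expectationD !(expectation_cst T0) -/a; lra.
move=> s; rewrite -lerBlDl -[leLHS]addrC.
have -> : - expectation (fun t => \prod_i (1 + h (t + s i))) +
   expectation (fun t => \prod_i (1 + clip (h (t + s i)) - a)) =
   expectation (fun t => \prod_i (1 + clip (h (t + s i)) - a) - \prod_i (1 + h (t + s i))).
  by rewrite expectationD -mulN1r -expectationZ addrC; congr (_ + _); apply: eq_expectation => t;
    rewrite mulN1r.
apply: (@le_trans _ _ (expectation (fun t => (M + 1) ^+ 4 *
     \sum_(i < 4) (`|h (t + s i) - clip (h (t + s i))| + `|a|)))).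
  apply: ler_expectation => t; apply: le_trans (ler_norm _) _.
  apply: le_trans (norm_prod_sub (L := M + 1) _ _ _) _.
  - by move: M1; lra.
  - move=> i; rewrite -addrA; apply: le_trans (ler_normD _ _) _; rewrite normr1.
    by have := bnd (t + s i); move: M1; lra.
  - move=> i; apply: le_trans (ler_normD _ _) _; rewrite normr1 addrC lerD2r.
    exact: hM.
  apply: ler_wpM2l; first by rewrite exprn_ge0 //; move: M1; lra.
  apply: ler_sum => i _.
  have -> : 1 + clip (h (t + s i)) - a - (1 + h (t + s i)) = - (h (t + s i) - clip (h (t + s i))) - a.
    by ring.
  by apply: le_trans (ler_normB _ _) _; rewrite normrN.
rewrite expectationZ expectation_sum; apply: ler_wpM2l; first by rewrite exprn_ge0 //; move: M1; lra.
rewrite (eq_bigr (fun=> expectation (fun t => `|h t - clip (h t)|) + `|a|)); last first.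
  move=> i _; rewrite expectationD (expectation_cst T0); congr (_ + _).
  exact: (expectation_shift (fun t => `|h t - clip (h t)|) (s i)).
rewrite sumr_const card_ord -mulr_natl; move: err a_le; rewrite -/eta; lra.
Qed.

End Truncation.

Lemma absz_sum_small (I : finType) (F : I -> int) (N : nat) :
  (\sum_i absz (F i) < N)%N -> forall i, `|F i| < N%:Z.
Proof.
move=> H i; rewrite -abszE ltz_nat; apply: leq_ltn_trans H.
by rewrite (bigD1 i) //= leq_addr.
Qed.

Lemma sum_ge_term (I : finType) (F : I -> int) i : (forall j, 0 <= F j) -> F i <= \sum_j F j.
Proof. by move=> F0; rewrite (bigD1 i) //= lerDl sumr_ge0. Qed.

Lemma base_exists (cf k lm : 'I_4 -> int) : exists D : int,
  [/\ 0 < D, forall s, 8 * `|cf s| < D, forall s i, 8 * `|cf s * k i| < D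
    & forall s, 8 * `|lm s| < D].
Proof.
have s1 : 0 <= \sum_s `|cf s| by rewrite sumr_ge0.
have s2 : 0 <= \sum_s \sum_i `|cf s * k i| by rewrite sumr_ge0 // => s _; rewrite sumr_ge0.
have s3 : 0 <= \sum_s `|lm s| by rewrite sumr_ge0.
exists (1 + 8 * (\sum_s `|cf s| + \sum_s \sum_i `|cf s * k i| + \sum_s `|lm s|)).
split=> [|s|s i|s].
- by lra.
- by have := @sum_ge_term _ (fun s => `|cf s|) s (fun=> normr_ge0 _); lra.
- have h1 := @sum_ge_term _ (fun i => `|cf s * k i|) i (fun=> normr_ge0 _).
  have h2 := @sum_ge_term _ (fun s => \sum_i `|cf s * k i|) s
    (fun j => sumr_ge0 _ (fun i _ => normr_ge0 _)).
  by move: h1 h2; lra.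
- by have := @sum_ge_term _ (fun s => `|lm s|) s (fun=> normr_ge0 _); lra.
Qed.

Lemma lt_sum7 (N n1 n2 n3 n4 n5 n6 n7 : nat) :
  (2 + n1 + n2 + n3 + n4 + n5 + n6 + n7 < N)%N ->
  (2 < N)%N /\ (n1 < N)%N /\ (n2 < N)%N /\ (n3 < N)%N /\ (n4 < N)%N /\ (n5 < N)%N /\
  (n6 < N)%N /\ (n7 < N)%N.
Proof. by lia. Qed.

(** * Balance of gain against losses *)

Section GainAndLoss.
Variable R : realType.
Variables (q nL K G : nat).
Hypothesis q_gt0 : (0 < q)%N.
Hypothesis K_def : (K = q.+1 * q ^ 4)%N.
Hypothesis K_le_G : (K <= G)%N.
Hypothesis G_large : (2 ^ 12 * (K * nL + 1) ^ 4 * (4 ^ 8 * nL ^ 8) * K ^ 5 <= G)%N.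

Let mu : R := K%:R / G%:R.
Let eps : R := q%:R^-1.

Let K_gt0 : (0 < K)%N. Proof. by rewrite K_def muln_gt0 expn_gt0 q_gt0. Qed.
Let G_gt0 : (0 < G)%N. Proof. exact: leq_trans K_gt0 K_le_G. Qed.
Let gR : 0 < (G%:R : R). Proof. by rewrite ltr0n. Qed.
Let kR : 0 < (K%:R : R). Proof. by rewrite ltr0n. Qed.
Let qR : 0 < (q%:R : R). Proof. by rewrite ltr0n. Qed.

Lemma mu_gt0 : 0 < mu. Proof. exact: divr_gt0. Qed.

Lemma mu_bound : 0 <= mu <= 1.
Proof. by rewrite ltW ?mu_gt0 //= ler_pdivrMr // mul1r ler_nat. Qed.

Lemma eps_bound : 0 <= eps <= 1.
Proof. by rewrite invr_ge0 ler0n /= invf_le1 // ler1n. Qed.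

Lemma mu_mul_G : G%:R * mu = K%:R.
Proof. by rewrite mulrC divfK // gt_eqF. Qed.

(** Put [Y = K mu^3 eps^W]. Since [K eps^4 = q + 1] and [W <= 4], [Y >= (q + 1) mu^3]. Of the gain
    [2 Y], one [Y] pays for the accidents because [q eps = 1], and the other exceeds the exceptional
    cost [q mu^3] by [mu^3]. *)
Lemma main_gain (W : nat) (X : R) : (W <= 4)%N -> 2 <= X ->
  - (G%:R * (mu ^+ 4 * eps ^+ W * X)) + q%:R * mu ^+ 3
    + G%:R * (q%:R * (mu ^+ 4 * eps ^+ W.+1)) <= - mu ^+ 3.
Proof.
move=> W4 X2; have /andP [e0 e1] := eps_bound; have m0 := mu_gt0.
have qe : q%:R * eps = 1 by rewrite divff // gt_eqF.
have -> : G%:R * (q%:R * (mu ^+ 4 * eps ^+ W.+1)) = G%:R * mu * mu ^+ 3 * eps ^+ W * (q%:R * eps).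
  by rewrite [eps ^+ W.+1]exprS; ring.
have -> : G%:R * (mu ^+ 4 * eps ^+ W * X) = G%:R * mu * mu ^+ 3 * eps ^+ W * X by ring.
rewrite qe mulr1 mu_mul_G.
have m3 : 0 < mu ^+ 3 by rewrite exprn_gt0.
have eW : eps ^+ 4 <= eps ^+ W by rewrite ler_wiXn2l.
have Ke : K%:R * eps ^+ 4 = q%:R + 1.
  rewrite K_def natrM natrX -mulrA -exprMn qe expr1n mulr1 -natr1.
  by [].
have h1 : (q%:R + 1) * mu ^+ 3 <= K%:R * mu ^+ 3 * eps ^+ W.
  rewrite -Ke; have -> : K%:R * eps ^+ 4 * mu ^+ 3 = K%:R * mu ^+ 3 * eps ^+ 4 by ring.
  by rewrite ler_wpM2l // mulr_ge0 ?ltW.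
set Y := K%:R * mu ^+ 3 * eps ^+ W in h1 *.
have Y0 : 0 <= Y by rewrite mulr_ge0 ?exprn_ge0 // mulr_ge0 ?ltW.
have h2 : 2 * Y <= Y * X by rewrite mulrC ler_wpM2l.
by lra.
Qed.

(** Since [G^4 mu^8 = K^5 mu^3 / G], a large [G] wins. In [2 ^ 12], the factor [2^10] is
    [4 * 2 * 2^7] and [2^2] comes from the target [mu^3 / 4]. *)
Lemma truncation_loss :
  ((K * nL)%N%:R + 1) ^+ 4 * (4 * (2 * (2 ^+ 7 *
    ((4 ^ 8 * (G ^ 4 * nL ^ 8))%N%:R * mu ^+ 8)))) <= mu ^+ 3 / 4 :> R.
Proof.
have -> : ((K * nL)%N%:R + 1 : R) = (K * nL + 1)%N%:R by rewrite natrD.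
have g0 : (G%:R : R) != 0 by rewrite gt_eqF.
have E (x y : nat) : (x * (G ^ 4 * y))%N%:R * mu ^+ 8 =
    (x * y)%N%:R * K%:R ^+ 5 / G%:R * mu ^+ 3 :> R.
  rewrite natrM natrM natrX natrM.
  have -> : mu ^+ 8 = mu ^+ 5 * mu ^+ 3 by rewrite -exprD.
  by rewrite {1}/mu expr_div_n; move: (mu ^+ 3) => z; field.
rewrite E.
have F (y z : nat) (u : R) : y%:R ^+ 4 * (4 * (2 * (2 ^+ 7 * (z%:R * K%:R ^+ 5 / G%:R * u)))) =
    2 ^+ 12 * y%:R ^+ 4 * z%:R * K%:R ^+ 5 / G%:R * (u / 4) by field.
have F' (y z : nat) : 2 ^+ 12 * y%:R ^+ 4 * z%:R * K%:R ^+ 5 = (2 ^ 12 * y ^ 4 * z * K ^ 5)%N%:R :> R.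
  by rewrite -!natrX -!natrM.
rewrite F F'.
have m3 : 0 <= mu ^+ 3 / 4 by rewrite divr_ge0 ?exprn_ge0 ?ltW ?mu_gt0.
by rewrite ler_piMl // ler_pdivrMr // mul1r ler_nat.
Qed.

End GainAndLoss.

(** The parameters [m, q, K, G] are fixed before the gaps, which makes [c0] uniform; only [D],
    [delta] and [N0] are chosen afterwards. *)
Lemma increasing_gaps_case (R : realType) : exists c0 : R, 0 < c0 /\
  forall a b c : int, 0 < a -> 0 < b -> a < c ->
  forall alpha : R, 0 < alpha -> alpha < 1 / 2 ->
  exists N0 : nat, forall N : nat, prime N -> (N0 < N)%N ->
  exists f : 'Z_N -> R,
    [/\ forall t : 'Z_N, 0 <= f t <= 1, alpha <= expectation f
      & forall d : 'Z_N, d != 0 ->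
        expectation (fun t : 'Z_N => \prod_(i < 4) f (t + (positions a b c i)%:~R * d))
        < (1 - c0) * alpha ^+ 4].
Proof.
have [m m_large] : exists m : nat, 2 <= (2 ^+ m - 1 - #|{ffun 'I_4 -> 'I_4}|%:R : R).
  (* There are [4^4 = 256] assignments, and [2^9 - 1 - 256 = 255]; [m = 8] would give a negative
     value. *)
  by exists 9%N; rewrite card_ffun !card_ord -natrX; lra.
pose q := local_count m; pose nL := #|{: 'I_4 * signvec m}|.
have q_gt0 : (0 < q)%N by apply/card_gt0P; exists [ffun=> None].
have nL_gt0 : (0 < nL)%N by apply/card_gt0P; exists (o0, zerovec m).
have [K K_def] : exists K, K = (q.+1 * q ^ 4)%N by exists (q.+1 * q ^ 4)%N.
have K_gt0 : (0 < K)%N by rewrite K_def muln_gt0 expn_gt0 q_gt0.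
have [G [K_le_G G_large]] : exists G, (K <= G)%N /\
    (2 ^ 12 * (K * nL + 1) ^ 4 * (4 ^ 8 * nL ^ 8) * K ^ 5 <= G)%N.
  exists (K + 2 ^ 12 * (K * nL + 1) ^ 4 * (4 ^ 8 * nL ^ 8) * K ^ 5)%N.
  by rewrite leq_addr leq_addl.
pose mu : R := K%:R / G%:R; pose eps : R := q%:R^-1.
have mu_pos : 0 < mu := mu_gt0 R q_gt0 K_def K_le_G.
have mu01 : 0 <= mu <= 1 := mu_bound R q_gt0 K_def K_le_G.
have eps01 : 0 <= eps <= 1 := eps_bound R q_gt0.
have m3 : 0 < mu ^+ 3 by rewrite exprn_gt0.
have TL := truncation_loss R q_gt0 K_def K_le_G G_large.
have [T8 T8E] : exists T8, T8 = (4 ^ 8 * (G ^ 4 * nL ^ 8))%N by exists (4 ^ 8 * (G ^ 4 * nL ^ 8))%N.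
rewrite -T8E -/mu in TL; clear G_large.
(* From the gain [mu^3], a quarter is lost to truncation and less than a quarter to the terms in
   [delta]; the rest exceeds [mu^3 / 4], which gives the strict inequality. *)
exists (mu ^+ 3 / 4); split; first by rewrite divr_gt0.
move=> a b c a_gt0 b_gt0 a_lt_c alpha alpha_gt0 alpha_lt.
have [cf [lm [wt LD]]] := local_data_exists a_gt0 b_gt0 a_lt_c.
set k := positions a b c in LD *.
have [D [D_gt0 D_c D_ck D_lam]] := base_exists cf k lm.
pose SK : R := \sum_(X : {ffun 'I_4 -> option (atom m G)}) `|pattern_coef wt mu eps X|.
pose S8 : R := \sum_(X : {ffun 'I_8 -> option (atom m G)}) `|\prod_(i < 8) pert_coef wt mu eps (X i)|.
pose S1 : R := \sum_(X : {ffun 'I_1 -> option (atom m G)}) `|\prod_(i < 1) pert_coef wt mu eps (X i)|.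
pose M : R := (K * nL)%N%:R.
have M1 : 1 <= M by rewrite ler1n muln_gt0 K_gt0.
pose Z : R := (M + 1) ^+ 4.
have Z0 : 0 <= Z by rewrite exprn_ge0 // addr_ge0 // ltW // (lt_le_trans ltr01).
have [SK0 S80 S10] : [/\ 0 <= SK, 0 <= S8 & 0 <= S1] by split; rewrite sumr_ge0.
(* Everything multiplied by [delta] in the final estimate, plus [1] to make it positive. *)
pose Ct : R := SK + Z * (4 * (2 * (2 ^+ 7 * S8) + S1)) + 1.
have Ct0 : 0 < Ct.
  by rewrite ltr_wpDl // addr_ge0 // mulr_ge0 // mulr_ge0 // addr_ge0 // !mulr_ge0 // exprn_ge0.
pose delta : R := mu ^+ 3 / 4 / Ct.
have delta_gt0 : 0 < delta by rewrite !divr_gt0.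
have delta_Ct : delta * Ct = mu ^+ 3 / 4 by rewrite divfK // gt_eqF.
pose P4 := {ffun 'I_4 -> option (atom m G)}.
pose P8 := {ffun 'I_8 -> option (atom m G)}.
(* Each of [n1] to [n6] dominates every integer in its sum, so for larger [N] vanishing modulo [N]
   means vanishing; [n7] ensures [N^(-1) <= delta^2]. *)
pose n1 := (\sum_(X : P4) absz (quad_sum D cf X))%N.
pose n2 := (\sum_(X : P4) absz (moment_sum D k cf X))%N.
pose n3 := (\sum_(X : P4) absz (lin_sum D lm X))%N.
pose n4 := (\sum_(XX : P4 * P4) absz (moment_sum D k cf XX.1 * lin_sum D lm XX.2 -
   moment_sum D k cf XX.2 * lin_sum D lm XX.1)%R)%N.
pose n5 := (\sum_(X : P8) absz (\sum_i quad_freq D cf (X i))%R)%N.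
pose n6 := (\sum_(x : option (atom m G)) absz (quad_freq D cf x))%N.
pose n7 := Num.Def.archi_bound ((delta ^+ 2)^-1).
exists (2 + n1 + n2 + n3 + n4 + n5 + n6 + n7)%N => N N_prime N_large.
have [N2 [l1 [l2 [l3 [l4 [l5 [l6 n7N]]]]]]] := lt_sum7 N_large.
have h1 := absz_sum_small l1; have h2 := absz_sum_small l2; have h3 := absz_sum_small l3.
have h4 := absz_sum_small l4; have h5 := absz_sum_small l5; have h6 := absz_sum_small l6.
have delta_N : (N%:R)^-1 <= delta ^+ 2.
  have d2 : 0 < delta ^+ 2 by rewrite exprn_gt0.
  rewrite invf_ple ?posrE // ?ltr0n ?prime_gt0 //; apply: (@le_trans _ _ n7%:R).
    by apply/ltW/archi_boundP; rewrite invr_ge0 ltW.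
  by rewrite ler_nat ltnW.
have delta_ge0 := ltW delta_gt0.
have [w w_prim] := primitive_root_exists (complex R) N_prime.
pose h : 'Z_N -> R := trig_poly w (@pert_coef R m G wt mu eps) (quad_freq D cf) (lin_freq D lm).
have hM t : `|h t| <= M.
  apply: le_trans (trig_poly_bound N_prime w_prim _ _ _ t) _.
  apply: le_trans (sum_pert_coef m G wt mu01 eps01) _.
  rewrite card_prod card_ord -/nL natrM mulrAC.
  by rewrite (mu_mul_G R q_gt0 K_def K_le_G) /M natrM.
have [g [g02 g1 gP]] := truncation M1 hM.
have E8 := eighth_moment_bound N_prime w_prim (lam := lm) LD D_gt0 D_c mu01 eps01 N2 delta_ge0 delta_N h5.
have E1 := mean_bound N_prime w_prim (lam := lm) LD D_gt0 D_c mu eps N2 delta_ge0 delta_N h6.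
exists (fun t => alpha * g t); split.
- move=> t; have /andP [g0 g2] := g02 t; apply/andP; split; first by rewrite mulr_ge0 // ltW.
  apply: (@le_trans _ _ (alpha * 2)); first by rewrite ler_wpM2l // ltW.
  by move: alpha_lt; clear; lra.
- by rewrite expectationZ g1 mulr1.
move=> d d0.
have -> : expectation (fun t : 'Z_N => \prod_(i < 4) (alpha * g (t + (k i)%:~R * d))) =
    alpha ^+ 4 * expectation (fun t : 'Z_N => \prod_(i < 4) g (t + (k i)%:~R * d)).
  by rewrite -expectationZ; apply: eq_expectation => t; rewrite big_split /= prodr_const card_ord.
rewrite mulrC ltr_pM2r ?exprn_gt0 //.
have := gP (fun i => (k i)%:~R * d).
have -> : expectation (fun t => \prod_(i < 4) (1 + h (t + (k i)%:~R * d))) =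
   expectation (fun t => \prod_(i < 4) trig_poly w (@coef R m G wt mu eps) (quad_freq D cf)
      (lin_freq D lm) (t + (k i)%:~R * d)).
  by apply: eq_expectation => t; apply: eq_bigr => i _; rewrite trig_poly_pert.
have CB := correlation_bound N_prime w_prim LD D_gt0 D_c D_ck D_lam mu01 eps01 d0 N2 delta_ge0
  delta_N h1 h2 h3 (fun X X' => h4 (X, X')).
have W4 : (weight wt <= 4)%N.
  case: LD => [[_ _ wt1] _ _ _]; rewrite /weight sum4n.
  by move: (wt1 o0) (wt1 o1) (wt1 o2) (wt1 o3); clear; lia.
have MG := main_gain q_gt0 K_def K_le_G W4 m_large.
move: CB; rewrite -/SK -/q => CB; move: E8; rewrite -/S8 -/nL -T8E => E8; move: E1; rewrite -/S1 => E1.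
move=> gB; apply: le_lt_trans gB _.
set A8 := expectation (fun t : 'Z_N => h t ^+ 8).
set A1 := `|expectation h|.
have A8le : A8 <= T8%:R * mu ^+ 8 + delta * S8 by exact: E8.
have A1le : A1 <= delta * S1 by exact: E1.
have errle : Z * (4 * (2 * (2 ^+ 7 * A8) + A1)) <=
   Z * (4 * (2 * (2 ^+ 7 * (T8%:R * mu ^+ 8 + delta * S8)) + delta * S1)).
  by rewrite ler_wpM2l //; move: A8le A1le; clear; lra.
have errE : Z * (4 * (2 * (2 ^+ 7 * (T8%:R * mu ^+ 8 + delta * S8)) + delta * S1)) =
  Z * (4 * (2 * (2 ^+ 7 * (T8%:R * mu ^+ 8)))) +
  delta * (Z * (4 * (2 * (2 ^+ 7 * S8) + S1))) by ring.
have dCt : delta * SK + delta * (Z * (4 * (2 * (2 ^+ 7 * S8) + S1))) + delta = mu ^+ 3 / 4.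
  by rewrite -delta_Ct /Ct; ring.
move: CB errle errE dCt MG TL m3 delta_gt0; rewrite -/mu -/eps -/M -/Z.
clear; lra.
Qed.

Theorem theorem6p2 (R : realType) :
  exists c : R, 0 < c /\
    forall k1 k2 k3 : nat,
      (0 < k1)%N -> (k1 < k2)%N -> (k2 < k3)%N -> k3 <> (k1 + k2)%N ->
    forall alpha : R, 0 < alpha -> alpha < 1 / 2 ->
    exists N0 : nat, forall N : nat, prime N -> (N0 < N)%N ->
    exists f : 'Z_N -> R,
      [/\ forall t : 'Z_N, 0 <= f t <= 1,
          alpha <= expectation (fun t : 'Z_N => f t)
        & forall d : 'Z_N, d != 0 ->
            expectation (fun t : 'Z_N =>
              f t * f (t + k1%:R * d) * f (t + k2%:R * d) * f (t + k3%:R * d))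
            < (1 - c) * alpha ^+ 4].
Proof.
have [c0 [c0_gt0 main]] := increasing_gaps_case R.
have prod4 (F : 'I_4 -> R) : \prod_(i < 4) F i = F o0 * F o1 * F o2 * F o3.
  rewrite !big_ord_recl big_ord0 mulr1 !mulrA.
  by do ![congr (_ * _)]; congr F; apply: val_inj.
exists c0; split=> // k1 k2 k3 k1_gt0 k12 k23 k3E alpha alpha_gt0 alpha_lt.
pose a : int := k1%:Z; pose b : int := k2%:Z - k1%:Z; pose c : int := k3%:Z - k2%:Z.
have a_gt0 : 0 < a by rewrite /a; lia.
have b_gt0 : 0 < b by rewrite /b; lia.
have c_gt0 : 0 < c by rewrite /c; lia.
have Eab : a + b = k2%:Z by rewrite /a /b; lia.
have Eabc : a + b + c = k3%:Z by rewrite /a /b /c; lia.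
have [ac|ca] : a < c \/ c < a by rewrite /a /c; lia.
  have [N0 H] := main a b c a_gt0 b_gt0 ac alpha alpha_gt0 alpha_lt.
  exists N0 => N N_prime N_large; have [f [f01 fa fd]] := H N N_prime N_large.
  exists f; split=> // d d0; have := fd d d0; congr (_ < _); apply: eq_expectation => t.
  by rewrite prod4 /positions /= Eabc Eab mul0r addr0.
(* Reflection: replacing [d] by [-d] and [t] by [t + k3 d] reverses the order of the four points and
   exchanges the outer gaps. *)
have [N0 H] := main c b a c_gt0 b_gt0 ca alpha alpha_gt0 alpha_lt.
exists N0 => N N_prime N_large; have [f [f01 fa fd]] := H N N_prime N_large.
exists f; split=> // d d0; have := fd (- d); rewrite oppr_eq0 => /(_ d0); congr (_ < _).
rewrite -(expectation_shift _ (k3%:R * d)); apply: eq_expectation => t; rewrite prod4 /positions /=.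
have shift (z : int) (n : nat) : z + n%:Z = k3%:Z ->
    t + k3%:R * d + z%:~R * - d = t + n%:R * d.
  move=> E; have -> : (k3%:R : 'Z_N) = z%:~R + n%:R.
    by rewrite -[k3%:R]/((k3%:Z)%:~R) -E rmorphD.
  by ring.
rewrite (shift 0 k3) ?add0r // (shift c k2); last by rewrite /c; lia.
rewrite (shift (c + b) k1); last by rewrite /c /b; lia.
rewrite (shift (c + b + a) 0%N); last by rewrite /a /b /c; lia.
by rewrite mul0r addr0; ring.
Qed.
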